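(* Let either $r_1,r_2\in\{\frac12,\frac13,\frac14,\frac16\}$ or $(r_1,r_2)\in\{(\frac15,\frac25),(\frac18,\frac38),(\frac1{10},\frac3{10}),(\frac1{12},\frac5{12})\}$, and let $d$ be the least common denominator of $r_1,r_2$. For $N=1,2,\dots$ put $$H(N)=\sum_{k=0}^{N-1}\frac{(r_1)_k(1-r_1)_k(r_2)_k(1-r_2)_k}{k!^4}.$$ Let $p$ be a prime with $p\nmid d$ such that $H(p)\not\equiv0\pmod p$. Then for all $s=1,2,\dots$, $$\frac{H(p^{s+1})}{H(p^s)}\equiv\frac{H(p^s)}{H(p^{s-1})}\pmod{p^3}.$$
   Context: Here $(a)_k=a(a+1)\cdots(a+k-1)$ is the shifted factorial. Congruences modulo powers of $p$ between rational numbers are understood in the ring $\mathbb Z_{(p)}$ of rationals with denominator prime to $p$ (equivalently, in $\mathbb Z_p$). *)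

(* Defs.v *)
From HB Require Import structures.
From mathcomp Require Import all_boot all_order all_algebra.

Set Implicit Arguments.
Unset Strict Implicit.
Unset Printing Implicit Defensive.

Import Order.TTheory GRing.Theory Num.Theory.
Local Open Scope ring_scope.

(* The shifted factorial (a)_k = a (a + 1) ... (a + k - 1), with (a)_0 = 1. *)
Definition shifted_fact (a : rat) (k : nat) : rat :=
  \prod_(i < k) (a + i%:R).

Definition H (r1 r2 : rat) (N : nat) : rat :=
  \sum_(k < N)
     (shifted_fact r1 k * shifted_fact (1 - r1) k *
      shifted_fact r2 k * shifted_fact (1 - r2) k) / (k`!)%:R ^+ 4.

(* Membership in Z_(p), for p prime; denq x is the positive denominator of x *)
(* in lowest terms.                                                          *)
Definition p_integral (p : nat) (x : rat) : bool := coprime `|denq x|%N p.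

(* Congruence modulo p ^ n in Z_(p): both sides lie in the ring, and their   *)
(* difference lies in the ideal generated by p ^ n.                          *)
Definition p_congr (p n : nat) (x y : rat) : Prop :=
  [/\ p_integral p x, p_integral p y &
      exists2 z : rat, p_integral p z & x - y = p%:R ^+ n * z].

Definition common_denom (r1 r2 : rat) : nat := lcmn `|denq r1|%N `|denq r2|%N.

(* Main.v *)
Require Import Defs.
From HB Require Import structures.
From mathcomp Require Import all_boot all_order all_algebra.
From mathcomp Require Import all_solvable all_field.
From mathcomp Require Import ring zify.

Set Implicit Arguments.
Unset Strict Implicit.
Unset Printing Implicit Defensive.

Import Order.TTheory GRing.Theory Num.Theory.
Local Open Scope ring_scope.

(* Write A(k) for the summand of H. Let a_i in {0, ..., p-1} be such that     *)
(* e_i = r_i + a_i is divisible by p, and r_i' = e_i / p. The Dwork map       *)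
(* r -> r' preserves {r1, 1-r1, r2, 1-r2}, and for 0 <= a < p one has exactly *)
(*   A(bp+a) / A(b) = +- Q(bp+a) G(bp+a) / (K_a(bp+e_1) K_a(bp+e_2)),         *)
(* where K_a(z) is the product of the z+a-m for 0 <= m < p, m <> a; G is a    *)
(* polynomial of degree 2p-2; and Q is a product of terms 1 - e_i^2/u^2 with  *)
(* p not dividing u, which for p >= 5 depends on a only modulo p^3. It        *)
(* remains to show that f(x), the sum over a of                               *)
(* G(x+a) / (K_a(x+e_1) K_a(x+e_2)), is constant modulo p^3 for x in pZ.      *)
(* Write f(x) = f_0 + f_1 x + f_2 x^2 modulo p^3. Modulo p, K_a(z) is         *)
(* z^(p-1) - 1 and the sum of the G(x+a) is constant, so p divides f_2 when   *)
(* p >= 5. The vanishing of the sum of the residues of the rational function  *)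
(* with numerator G and simple poles at the 2p points a - e_i says            *)
(* that f(-e_1) = f(-e_2), hence f_1 = (e_1 + e_2) f_2 = 0 modulo p^2.        *)
(* So H(p^(s+1)) = H(p^s) H(p) modulo p^3. For p = 2, 3 the block sums are    *)
(* not constant modulo p^3, but each b for which the sum differs from f(0)    *)
(* has A(b) divisible by p, while the difference is divisible by p^2.         *)

(** * Congruences in Z_(p) *)

(** Both quotients in the theorem are congruent to [H r1 r2 p], because H is multiplicative along
    powers of p: H(p^(s+1)) = H(p^s) H(p) modulo p^3 ([H_mul], and [H_mul_small] for p = 2, 3). As
    H(p) is a unit, [ratio_congr] then concludes. Grouping the summation index as k = bp + a reduces
    multiplicativity to one block: by the exact identity [poch_block] the block sum is A(b) f(b),
    where f(0) = H(p). For p >= 5, f is constant modulo p^3 ([block_sum_const]). Up to the harmless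
    factors [Qprod], f(b) is the value at bp of an integer polynomial P = [Ppol]. Two independent
    arguments control P. Modulo p, averaging over translations gives P as a constant times a power
    of X^(p-1) - 1 ([sum_shift_const], [Ppol_Fp]), so p divides the coefficient of X and, for p >=
    5, that of X^2. Globally, the residue theorem gives P(-e1) = P(-e2) to high precision
    ([sum_residues], [Ppol_symm]); cancelling e2 - e1 turns this into the vanishing of the linear
    coefficient modulo p^2 ([Ppol_const]). The listed parameters enter through [dwork_stable]: the
    Dwork map preserves the product of the two factors [poch]. *)

Definition Zloc (p : nat) : {pred rat} := fun x => p_integral p x.

Lemma ZlocP p (x : rat) :
  reflect (exists n m : int, [/\ m != 0, coprime `|m| p & x = n%:~R / m%:~R])
          (x \in Zloc p).
Proof.
apply: (iffP idP) => [xp | [n [m [m0 cop ->]]]].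
  by exists (numq x), (denq x); rewrite divq_num_den denq_neq0.
rewrite unfold_in /p_integral; apply: coprime_dvdl cop.
set y := _ / _.
have: y * m%:~R = n%:~R by rewrite mulfVK // intr_eq0.
rewrite -{1}[y]divq_num_den => e.
have {}e : numq y * m = n * denq y.
  apply: (@intr_inj rat); rewrite !rmorphM /= -e.
  by rewrite mulrAC divfK // intr_eq0 denq_neq0.
have: (`|denq y| %| absz (numq y * m)%R)%N by rewrite e abszM dvdn_mull.
by rewrite abszM Gauss_dvdr // coprime_sym coprime_num_den.
Qed.

Lemma Zloc_subring p : subring_closed (Zloc p).
Proof.
split=> [|x y /ZlocP[a [b [b0 bp ->]]] /ZlocP[c [d [d0 dp ->]]]
         |x y /ZlocP[a [b [b0 bp ->]]] /ZlocP[c [d [d0 dp ->]]]].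
- by apply/ZlocP; exists 1, 1; rewrite /= coprime1n divr1.
- apply/ZlocP; exists (a * d - c * b), (b * d).
  rewrite mulf_neq0 // abszM coprimeMl bp dp; split=> //.
  have b0' : b%:~R != 0 :> rat by rewrite intr_eq0.
  have d0' : d%:~R != 0 :> rat by rewrite intr_eq0.
  by rewrite rmorphB !rmorphM /=; field; rewrite b0' d0'.
- apply/ZlocP; exists (a * c), (b * d).
  rewrite mulf_neq0 // abszM coprimeMl bp dp; split=> //.
  by rewrite !rmorphM /= mulf_div.
Qed.

HB.instance Definition _ p :=
  GRing.isSubringClosed.Build rat (Zloc p) (Zloc_subring p).

Lemma Zloc_int p (n : int) : n%:~R \in Zloc p.
Proof. by apply/ZlocP; exists n, 1; rewrite /= coprime1n divr1. Qed.

Lemma Zloc_nat p n : n%:R \in Zloc p.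
Proof. exact: (Zloc_int p n). Qed.

(** Unlike [p_congr], this is a boolean and asks nothing of x and y separately; [pcong_int]
    transfers integrality across it. *)
Definition pcong p n (x y : rat) := (x - y) / p%:R ^+ n \in Zloc p.

Definition Zunit p (x : rat) := [&& x != 0, x \in Zloc p & x^-1 \in Zloc p].

Lemma ZunitW p x : Zunit p x -> x \in Zloc p. Proof. by case/and3P. Qed.
Lemma ZunitV p x : Zunit p x -> x^-1 \in Zloc p. Proof. by case/and3P. Qed.
Lemma Zunit_neq0 p x : Zunit p x -> x != 0. Proof. by case/and3P. Qed.

Lemma Zunit1 p : Zunit p 1.
Proof. by rewrite /Zunit oner_neq0 invr1 !rpred1. Qed.

Lemma ZunitM p x y : Zunit p x -> Zunit p y -> Zunit p (x * y).
Proof.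
move=> /and3P[x0 xi xv] /and3P[y0 yi yv].
by rewrite /Zunit mulf_neq0 // invfM !rpredM.
Qed.

Lemma Zunit_prod p (I : Type) (r : seq I) (P : pred I) (F : I -> rat) :
  (forall i, P i -> Zunit p (F i)) -> Zunit p (\prod_(i <- r | P i) F i).
Proof. move=> h; apply: (big_ind (fun x => Zunit p x)) => //; first exact: Zunit1.
exact: ZunitM. Qed.

Lemma Zunit_int p (n : int) : n != 0 -> coprime `|n| p -> Zunit p n%:~R.
Proof.
move=> n0 cn; apply/and3P; split; rewrite ?intr_eq0 ?Zloc_int //.
by apply/ZlocP; exists 1, n; rewrite mul1r.
Qed.

Lemma pcong_refl p n x : pcong p n x x.
Proof. by rewrite /pcong subrr mul0r rpred0. Qed.
#[global] Hint Resolve pcong_refl : core.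

Lemma pcong_sym p n x y : pcong p n x y -> pcong p n y x.
Proof. by rewrite /pcong -[y - x]opprB mulNr rpredN. Qed.

Lemma pcong_trans p n y x z : pcong p n x y -> pcong p n y z -> pcong p n x z.
Proof.
move=> xy yz; rewrite /pcong; have -> : x - z = (x - y) + (y - z) by ring.
by rewrite mulrDl rpredD.
Qed.

Lemma pcongD p n x x' y y' :
  pcong p n x x' -> pcong p n y y' -> pcong p n (x + y) (x' + y').
Proof. by move=> h k; rewrite /pcong opprD addrACA mulrDl rpredD. Qed.

Lemma pcongN p n x x' : pcong p n x x' -> pcong p n (- x) (- x').
Proof. by move=> h; rewrite /pcong -opprD mulNr rpredN. Qed.

Lemma pcongB p n x x' y y' :
  pcong p n x x' -> pcong p n y y' -> pcong p n (x - y) (x' - y').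
Proof. by move=> h k; apply: pcongD => //; apply: pcongN. Qed.

Lemma pcong_sum p n (I : Type) (r : seq I) (P : pred I) (F G : I -> rat) :
  (forall i, P i -> pcong p n (F i) (G i)) ->
  pcong p n (\sum_(i <- r | P i) F i) (\sum_(i <- r | P i) G i).
Proof.
by move=> h; apply: (big_ind2 (pcong p n)) => // *; apply: pcongD.
Qed.

Lemma pcongM p n x x' y y' : x \in Zloc p -> y' \in Zloc p ->
  pcong p n x x' -> pcong p n y y' -> pcong p n (x * y) (x' * y').
Proof.
move=> xi yi h k; rewrite /pcong.
have -> : x * y - x' * y' = x * (y - y') + (x - x') * y' by ring.
by rewrite mulrDl -mulrA mulrAC rpredD // rpredM.
Qed.

Lemma pcongMl p n c x y : c \in Zloc p ->
  pcong p n x y -> pcong p n (c * x) (c * y).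
Proof. by move=> ci h; rewrite /pcong -mulrBr -mulrA rpredM. Qed.

Lemma pcongMr p n c x y : c \in Zloc p ->
  pcong p n x y -> pcong p n (x * c) (y * c).
Proof. by move=> ci h; rewrite ![_ * c]mulrC; apply: pcongMl. Qed.

Section PrimeLocal.

Variables (p : nat) (p_pr : prime p).

Let p0 : p%:R != 0 :> rat.
Proof. by rewrite pnatr_eq0 -lt0n prime_gt0. Qed.

Let pX0 n : p%:R ^+ n != 0 :> rat.
Proof. exact: expf_neq0. Qed.

Lemma pcong_int n x y : pcong p n x y -> (x \in Zloc p) = (y \in Zloc p).
Proof.
move=> h.
have hi : x - y \in Zloc p.
  by rewrite -[x - y](divfK (pX0 n)) rpredM ?rpredX ?Zloc_nat.
by rewrite -[x in LHS](subrK y) rpredDl.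
Qed.

Lemma pcong_leq m n x y : (m <= n)%N -> pcong p n x y -> pcong p m x y.
Proof.
move=> mn h; rewrite /pcong.
have -> : (x - y) / p%:R ^+ m = p%:R ^+ (n - m) * ((x - y) / p%:R ^+ n).
  by rewrite -{2}(subnK mn) exprD; field; rewrite !pX0.
by rewrite rpredM ?rpredX ?Zloc_nat.
Qed.

Lemma pcong_mul0 m n x y : pcong p m x 0 -> pcong p n y 0 ->
  pcong p (m + n) (x * y) 0.
Proof.
rewrite /pcong !subr0 => hx hy.
by rewrite exprD invfM mulrACA rpredM.
Qed.

Lemma pcong_pX n z : z \in Zloc p -> pcong p n (p%:R ^+ n * z) 0.
Proof. by move=> zi; rewrite /pcong subr0 mulrC mulKf. Qed.

Lemma pcongP n x y :
  reflect (exists2 z, z \in Zloc p & x - y = p%:R ^+ n * z) (pcong p n x y).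
Proof.
apply: (iffP idP) => [h | [z zi e]].
  by exists ((x - y) / p%:R ^+ n) => //; rewrite mulrC divfK.
by rewrite /pcong e mulrC mulKf.
Qed.

Lemma pcong_sub0 n x y : pcong p n (x - y) 0 = pcong p n x y.
Proof. by rewrite /pcong subr0. Qed.

Lemma pcong_prod n (I : Type) (r : seq I) (P : pred I) (F G : I -> rat) :
    (forall i, P i -> F i \in Zloc p) ->
    (forall i, P i -> pcong p n (F i) (G i)) ->
  pcong p n (\prod_(i <- r | P i) F i) (\prod_(i <- r | P i) G i).
Proof.
move=> Fi h.
have [] : \prod_(i <- r | P i) G i \in Zloc p /\
          pcong p n (\prod_(i <- r | P i) F i) (\prod_(i <- r | P i) G i).
  apply: (big_ind2 (fun x y => y \in Zloc p /\ pcong p n x y)).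
  - by rewrite rpred1.
  - move=> x1 x2 y1 y2 [a b] [c d]; split; first exact: rpredM.
    by apply: pcongM => //; rewrite (pcong_int b).
  - by move=> i Pi; rewrite -(pcong_int (h i Pi)) Fi ?h.
by [].
Qed.

Lemma pcong_exp n k x y : x \in Zloc p -> pcong p n x y ->
  pcong p n (x ^+ k) (y ^+ k).
Proof.
move=> xi h; elim: k => [|k IH]; rewrite ?expr0 // !exprS.
by apply: pcongM => //; rewrite rpredX // -(pcong_int h).
Qed.

Lemma pcongV n x y : Zunit p x -> Zunit p y ->
  pcong p n x y -> pcong p n x^-1 y^-1.
Proof.
move=> /and3P[x0 xi xv] /and3P[y0 yi yv] h; rewrite /pcong.
have -> : x^-1 - y^-1 = - (x - y) * (x^-1 * y^-1) by field; rewrite x0 y0.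
by rewrite mulrAC mulNr rpredM ?rpredN // rpredM.
Qed.

Lemma pcong_intr n (a b : int) :
  (a == b %[mod (p ^ n)%N])%Z -> pcong p n a%:~R b%:~R.
Proof.
rewrite eqz_mod_dvd => /dvdzP[c e].
rewrite /pcong -rmorphB /= e rmorphM /=.
have -> : ((p ^ n)%N : int)%:~R = p%:R ^+ n :> rat by rewrite -natrX.
by rewrite mulfK // Zloc_int.
Qed.

Lemma pcong_intr_dvd n (a : int) :
  pcong p n a%:~R 0 -> (p ^ n %| `|a|)%N.
Proof.
move=> /pcongP[z /ZlocP[u [v [v0 cv ->]]]]; rewrite subr0 => e.
have {}e : a * v = (p ^ n)%N%:Z * u.
  apply: (@intr_inj rat); rewrite !rmorphM /= e.
  have v0' : v%:~R != 0 :> rat by rewrite intr_eq0.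
  rewrite -[((p ^ n)%N : int)%:~R]/((p ^ n)%N%:R) natrX; field.
  by rewrite v0'.
have: (p ^ n %| absz (a * v)%R)%N by rewrite e abszM dvdn_mulr.
by rewrite abszM Gauss_dvdl // coprime_sym coprimeXr.
Qed.

(** The ring Z_(p) is local with maximal ideal generated by p. This turns H(p) nonzero modulo p into
    H(p) invertible. *)
Lemma Zunit_dichotomy x : x \in Zloc p -> Zunit p x \/ pcong p 1 x 0.
Proof.
move=> xi; case/ZlocP: (xi) => n [m [m0 cm ex]].
have [n0|n0] := eqVneq n 0.
  by right; rewrite ex n0 mul0r.
have [cn|] := boolP (coprime `|n| p).
  left; rewrite ex; apply: ZunitM; first exact: Zunit_int.
  have /and3P[a b c] := Zunit_int m0 cm.
  by rewrite /Zunit invr_eq0 invrK a b c.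
rewrite coprime_sym prime_coprime // negbK => pn; right.
rewrite ex -[X in pcong _ _ _ X](mul0r (m%:~R^-1)); apply: pcongMr.
  by have /and3P[] := Zunit_int m0 cm.
by apply: (@pcong_intr 1 n 0); rewrite eqz_mod_dvd subr0 dvdzE /= expn1.
Qed.

Lemma Zunit_ncong0 x : Zunit p x -> ~ pcong p 1 x 0.
Proof.
move=> /and3P[x0 xi xv]; rewrite /pcong subr0 expr1 => h.
have : (p%:R)^-1 \in Zloc p.
  by have := rpredM xv h; rewrite mulrA mulVf // mul1r.
move=> h1; have /pcong_intr_dvd : pcong p 1 1%:~R 0.
  by rewrite /pcong subr0 expr1 mul1r.
by rewrite expn1 dvdn1 => /eqP ep; move: p_pr; rewrite ep.
Qed.

Lemma Zunit_cong n x y : (0 < n)%N -> pcong p n x y -> Zunit p x -> Zunit p y.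
Proof.
move=> n0 h xu.
have yi : y \in Zloc p by rewrite -(pcong_int h) ZunitW.
have [//|y0] := Zunit_dichotomy yi.
case: (Zunit_ncong0 xu); apply: pcong_trans y0.
exact: pcong_leq h.
Qed.

End PrimeLocal.

(** Lagrange interpolation at the nodes z_i recovers G. The coefficient of degree [#|I| - 1] of the
    interpolant is this sum, which is the sum of the residues of G / prod (X - z_i), and G has no
    term of that degree. *)
Lemma sum_residues (F : fieldType) (I : finType) (z : I -> F) (G : {poly F}) :
  injective z -> (size G < #|I|)%N ->
  \sum_i G.[z i] / \prod_(j | j != i) (z i - z j) = 0.
Proof.
move=> zi sG.
pose w i := \prod_(j | j != i) (z i - z j).
have w0 i : w i != 0.
  apply/prodf_neq0 => j ji; rewrite subr_eq0; apply: contra ji => /eqP e.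
  by apply/eqP; apply: zi.
pose l i : {poly F} := \prod_(j <- enum (predC1 i)) ('X - (z j)%:P).
have sl i : size (l i) = #|I|.
  by rewrite size_prod_XsubC -cardE cardC1 prednK //; apply/card_gt0P; exists i.
have lm i : lead_coef (l i) = 1.
  by apply/eqP; rewrite -[_ == 1]/(l i \is monic) monic_prod_XsubC.
have lz i k : (l i).[z k] = if k == i then w i else 0.
  rewrite horner_prod big_enum; case: eqVneq => [->|ki].
    by apply: eq_bigr => j _; rewrite hornerXsubC.
  by rewrite (bigD1 k) //= hornerXsubC subrr mul0r.
pose L := \sum_i (G.[z i] / w i) *: l i.
have GL : G - L = 0.
  apply: (@roots_geq_poly_eq0 _ _ [seq z i | i <- enum I]).
  - apply/allP => _ /mapP[k _ ->]; rewrite /root !hornerE horner_sum.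
    rewrite (bigD1 k) //= big1 => [|i ik]; rewrite hornerZ lz.
      by rewrite eqxx divfK // addr0 subrr.
    by rewrite eq_sym (negPf ik) mulr0.
  - by rewrite map_inj_uniq // enum_uniq.
  - rewrite size_map -cardE; apply: leq_trans (size_polyD _ _) _.
    rewrite geq_max (ltnW sG) size_polyN.
    apply: leq_trans (size_sum _ _ _) _; apply/bigmax_leqP => i _.
    by apply: leq_trans (size_scale_leq _ _) _; rewrite sl.
have: (G - L)`_(#|I|.-1) = 0 by rewrite GL coef0.
rewrite coefB (@nth_default _ _ G); last by rewrite -ltnS (ltn_predK sG).
rewrite sub0r => /eqP; rewrite oppr_eq0 => /eqP L0; apply: etrans L0.
rewrite /L coef_sum; apply: eq_bigr => i _; rewrite coefZ.
by have := lm i; rewrite lead_coefE sl => ->; rewrite mulr1.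
Qed.

(** * Polynomials over F_p *)

Lemma size_prod_leqS (R : idomainType) (I : Type) (r : seq I) (F : I -> {poly R}) :
  (forall i, (size (F i) <= 2)%N) -> (size (\prod_(i <- r) F i)%R <= (size r).+1)%N.
Proof.
move=> h; elim: r => [|i r IH]; first by rewrite big_nil size_poly1.
rewrite big_cons /=; apply: leq_trans (size_polyMleq _ _) _.
by rewrite -subn1 leq_subLR (leq_trans (leq_add (h i) IH)).
Qed.

Section PrimeField.

Variables (p : nat) (p_pr : prime p).

Lemma big_Fp (R : Type) (idx : R) (op : Monoid.com_law idx) (F : 'F_p -> R) :
  \big[op/idx]_(x : 'F_p) F x = \big[op/idx]_(a < p) F a%:R.
Proof.
rewrite (reindex (fun a : 'I_p => a%:R : 'F_p)) //=; apply: onW_bij.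
apply: inj_card_bij; last by rewrite card_Fp // card_ord.
move=> a b /(congr1 val) /=; rewrite !val_Fp_nat // !modn_small //.
by move/val_inj.
Qed.

Lemma prod_Xsub_Fp : \prod_(x : 'F_p) ('X - x%:P) = 'X^p - 'X :> {poly 'F_p}.
Proof. by rewrite -finField_genPoly card_Fp. Qed.

(** This is [sum_residues] with all of ['F_p] as nodes: every denominator is the product of the
    nonzero elements, so it factors out. *)
Lemma sum_Fp_small (h : {poly 'F_p}) : (size h < p)%N -> \sum_(x : 'F_p) h.[x] = 0.
Proof.
move=> sh; have := @sum_residues _ _ id h (fun _ _ e => e).
rewrite card_Fp // => /(_ sh).
have w i : \prod_(j | j != i) (i - j) = \prod_(j : 'F_p | j != 0) j.
  rewrite (reindex_inj (inv_inj (subKr i))) /=.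
  apply: eq_big => [j|j _]; last by rewrite subKr.
  by rewrite -subr_eq0 addrAC subrr add0r oppr_eq0.
under eq_bigr => i _ do rewrite w.
rewrite -mulr_suml => /eqP; rewrite mulf_eq0 invr_eq0 => /orP[/eqP //|].
by have /prodf_neq0 /negPf -> : forall j : 'F_p, j != 0 -> j != 0.
Qed.

Let shift_size (h : {poly 'F_p}) x : size (h \Po ('X + x%:P)) = size h.
Proof. by rewrite size_comp_poly2 // -[x]opprK rmorphN /= size_XsubC. Qed.

Let root_all (h : {poly 'F_p}) : (forall x, h.[x] = 0) -> (size h <= p)%N -> h = 0.
Proof.
move=> h0 sh; apply: (@roots_geq_poly_eq0 _ _ (enum 'F_p)).
- by apply/allP => x _; rewrite /root h0.
- exact: enum_uniq.
- by rewrite -cardE card_Fp.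
Qed.

Let sum_shift_horner (h : {poly 'F_p}) y :
  (\sum_(x : 'F_p) (h \Po ('X + x%:P))).[y] = \sum_(x : 'F_p) h.[x].
Proof.
rewrite horner_sum [RHS](reindex_inj (addrI y)) /=.
by apply: eq_bigr => x _; rewrite horner_comp !hornerE.
Qed.

Let sum_shift_size (h : {poly 'F_p}) :
  (size (\sum_(x : 'F_p) (h \Po ('X + x%:P)))%R <= size h)%N.
Proof.
apply: leq_trans (size_sum _ _ _) _; apply/bigmax_leqP => x _.
by rewrite shift_size.
Qed.

(* Modulo X^p - X, which is invariant under all translations, only degrees   *)
(* below p matter: the translates of a polynomial of degree < p - 1 sum to 0, *)
(* those of a polynomial of degree p - 1 to a constant.                      *)
Lemma sum_shift_const (G : {poly 'F_p}) : (size G <= (2 * p).-1)%N ->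
  exists c, \sum_(x : 'F_p) (G \Po ('X + x%:P)) = c%:P.
Proof.
have p1 := prime_gt1 p_pr.
move=> sG; pose D : {poly 'F_p} := 'X^p - 'X.
have sD : size D = p.+1.
  by rewrite size_polyDl ?size_polyXn // size_polyN size_polyX ltnS.
have D0 : D != 0 by rewrite -size_poly_gt0 sD.
have DE x : D \Po ('X + x%:P) = D.
  rewrite /D -prod_Xsub_Fp rmorph_prod /= [RHS](reindex_inj (subIr x)) /=.
  apply: eq_bigr => y _; rewrite comp_polyB comp_polyX comp_polyC polyCB.
  by rewrite opprB addrA.
have s1 : (size (G %/ D)%R < p)%N.
  rewrite size_divp // sD /=.
  by apply: leq_ltn_trans (leq_sub2r _ sG) _; lia.
have s0 : (size (G %% D)%R <= p)%N by rewrite -ltnS -sD ltn_modp.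
(* The quotient by D has size below p, so its translates sum to 0 at every point; a polynomial of
   size at most p that vanishes on all of ['F_p] is zero. Only the remainder is left. *)
have E : \sum_(x : 'F_p) (G \Po ('X + x%:P)) =
         \sum_(x : 'F_p) ((G %% D) \Po ('X + x%:P)).
  transitivity (\sum_(x : 'F_p) ((G %/ D \Po ('X + x%:P)) * D +
                                 (G %% D \Po ('X + x%:P)))).
    apply: eq_bigr => x _.
    by rewrite {1}(divp_eq G D) comp_polyD comp_polyM DE.
  rewrite big_split /= -mulr_suml [X in X * D]root_all ?mul0r ?add0r // => [y|].
    by rewrite sum_shift_horner sum_Fp_small.
  by apply: leq_trans (sum_shift_size _) _; apply: ltnW.
exists (\sum_(x : 'F_p) (G %% D).[x]).
rewrite E; apply/eqP; rewrite -subr_eq0; apply/eqP; apply: root_all => [y|].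
  by rewrite !hornerE sum_shift_horner subrr.
apply: leq_trans (size_polyD _ _) _; rewrite geq_max size_polyN.
rewrite (leq_trans (sum_shift_size _) s0) /=.
by apply: leq_trans (size_polyC_leq1 _) _; lia.
Qed.

End PrimeField.

(** * The local factors and the polynomial that interpolates the block sums *)

(** With r = e - al and t = bp + a, this is the numerator left in [poch r t / poch (e / p) b] once
    sign, [Qprod] and [kfac] are split off ([poch_block]). The ring is arbitrary so that the same
    expression can be read in [int], [rat], ['F_p] and polynomials over them. *)
Definition gfac (R : comNzRingType) (p al : nat) (e t : R) : R :=
  (\prod_(m < al) (t + m.+1%:R - e)) * \prod_(al.+1 <= j < p) (t - j%:R + e).

Definition kfac (R : comNzRingType) (p a : nat) (z : R) : R :=
  \prod_(m < p | (m : nat) != a) (z + a%:R - m%:R).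

Lemma rmorph_gfac (R S : comNzRingType) (f : {rmorphism R -> S}) p al e t :
  f (gfac p al e t) = gfac p al (f e) (f t).
Proof.
rewrite rmorphM !rmorph_prod; congr (_ * _); apply: eq_bigr => j _.
  by rewrite rmorphB rmorphD rmorph_nat.
by rewrite rmorphD rmorphB rmorph_nat.
Qed.

Lemma rmorph_kfac (R S : comNzRingType) (f : {rmorphism R -> S}) p a z :
  f (kfac p a z) = kfac p a (f z).
Proof.
rewrite rmorph_prod; apply: eq_bigr => j _.
by rewrite rmorphB rmorphD !rmorph_nat.
Qed.

Lemma kfac_prod (R : comNzRingType) p a (z : R) : (a < p)%N ->
  z * kfac p a z = \prod_(m < p) (z + a%:R - m%:R).
Proof.
move=> ap; rewrite [RHS](bigD1 (Ordinal ap)) //= addrK; congr (_ * _).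
Qed.

Lemma size_gfac (R : idomainType) p al (e : R) : (al < p)%N ->
  (size (gfac p al e%:P 'X)%R <= p)%N.
Proof.
move=> alp; rewrite /gfac; apply: leq_trans (size_polyMleq _ _) _.
have s2 (c : R) : (size ('X + c%:P)%R <= 2)%N by rewrite size_XaddC.
have h1 : (size (\prod_(m < al) ('X + m.+1%:R - e%:P))%R <= al.+1)%N.
  apply: leq_trans (size_prod_leqS _ _) _ => [m|].
    by rewrite -polyC_natr -polyCN -addrA -polyCD.
  by rewrite -[index_enum _]enumT -cardE card_ord.
have h2 : (size (\prod_(al.+1 <= j < p) ('X - j%:R + e%:P))%R <= (p - al.+1).+1)%N.
  apply: leq_trans (size_prod_leqS _ _) _ => [m|].
    by rewrite -polyC_natr -polyCN -addrA -polyCD.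
  by rewrite size_iota.
by rewrite -subn1 leq_subLR (leq_trans (leq_add h1 h2)) //; lia.
Qed.

(** The shifts a - m run through all of ['F_p], so this is (X^p - X) / X whatever a is. *)
Lemma kfac_Fp p a : prime p -> (a < p)%N ->
  kfac p a 'X = ('X^(p.-1) - 1)%R :> {poly 'F_p}.
Proof.
move=> p_pr ap; have X0 : 'X != 0 :> {poly 'F_p} by rewrite polyX_eq0.
apply: (mulfI X0); rewrite kfac_prod //.
rewrite mulrBr mulr1 -exprS prednK ?prime_gt0 //.
rewrite -prod_Xsub_Fp // (reindex_inj (subIr a%:R)) /=.
rewrite [RHS]big_Fp //; apply: eq_bigr => m _.
rewrite polyCB !polyC_natr; ring.
Qed.

Definition Gpol (R : comNzRingType) (p al1 al2 : nat) (e1 e2 t : R) : R :=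
  gfac p al1 e1 t * gfac p al2 e2 t.

(* The exponent [N] will be [phi (p ^ M) - 1], so that the powers [^+ N]     *)
(* stand for inverses modulo [p ^ M].                                         *)
Definition Ppol (p al1 al2 N : nat) (e1 e2 : int) : {poly int} :=
  \sum_(a < p) Gpol p al1 al2 e1%:P e2%:P ('X + a%:R) *
    (kfac p a ('X + e1%:P) ^+ N * kfac p a ('X + e2%:P) ^+ N).

Lemma rmorph_Gpol (R S : comNzRingType) (f : {rmorphism R -> S}) p al1 al2 e1 e2 t :
  f (Gpol p al1 al2 e1 e2 t) = Gpol p al1 al2 (f e1) (f e2) (f t).
Proof. by rewrite rmorphM !rmorph_gfac. Qed.

Lemma horner_Gpol (R : comNzRingType) p al1 al2 (e1 e2 : R) (h : {poly R}) x :
  (Gpol p al1 al2 e1%:P e2%:P h).[x] = Gpol p al1 al2 e1 e2 h.[x].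
Proof. by rewrite -!horner_evalE rmorph_Gpol /= !horner_evalE !hornerC. Qed.

Lemma horner_Ppol p al1 al2 N e1 e2 x :
  (Ppol p al1 al2 N e1 e2).[x] =
  \sum_(a < p) Gpol p al1 al2 e1 e2 (x + a%:R) *
    (kfac p a (x + e1) ^+ N * kfac p a (x + e2) ^+ N).
Proof.
rewrite horner_sum; apply: eq_bigr => a _.
rewrite hornerM horner_Gpol hornerM !horner_exp -![(kfac _ _ _).[_]]horner_evalE.
rewrite !rmorph_kfac /= /horner_eval.
by rewrite !hornerE -polyC_natr hornerC.
Qed.

Lemma size_Gpol (R : idomainType) p al1 al2 (e1 e2 : R) :
  (al1 < p)%N -> (al2 < p)%N ->
  (size (Gpol p al1 al2 e1%:P e2%:P 'X)%R <= (2 * p).-1)%N.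
Proof.
move=> h1 h2; apply: leq_trans (size_polyMleq _ _) _.
have := leq_add (size_gfac e1 h1) (size_gfac e2 h2).
by rewrite addnn -mul2n => h; rewrite -subn1 -[(2 * p).-1]subn1 leq_sub2r.
Qed.

Section Coefficients.

Variables (p : nat) (p_pr : prime p) (al1 al2 N : nat) (e1 e2 : int).
Hypotheses (h1 : (al1 < p)%N) (h2 : (al2 < p)%N).
Hypotheses (d1 : (p%:Z %| e1)%Z) (d2 : (p%:Z %| e2)%Z).

Lemma intr_Fp0 (n : int) : (p%:Z %| n)%Z = (n%:~R == 0 :> 'F_p).
Proof.
have ch := pchar_Fp p_pr; case: n => n; rewrite dvdzE /=.
  by rewrite -pmulrn -(dvdn_pcharf ch).
by rewrite NegzE mulrNz oppr_eq0 -pmulrn -(dvdn_pcharf ch).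
Qed.

(** Modulo p both e1 and e2 vanish, so by [kfac_Fp] the power factors are the same for all a and
    leave the sum. What remains is a sum of translates of a polynomial of size at most 2p - 1,
    constant by [sum_shift_const]. *)
Lemma Ppol_Fp : exists c : 'F_p,
  map_poly intr (Ppol p al1 al2 N e1 e2) = c *: ('X^(p.-1) - 1) ^+ (2 * N).
Proof.
have z1 : e1%:~R = 0 :> 'F_p by apply/eqP; rewrite -intr_Fp0.
have z2 : e2%:~R = 0 :> 'F_p by apply/eqP; rewrite -intr_Fp0.
pose G : {poly 'F_p} := Gpol p al1 al2 0%:P 0%:P 'X.
have [c cE] := sum_shift_const p_pr (size_Gpol 0 0 h1 h2).
exists c; rewrite -mul_polyC -cE big_Fp // mulr_suml rmorph_sum /=.
apply: eq_bigr => a _; rewrite rmorphM /= rmorph_Gpol rmorphM !rmorphXn /=.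
rewrite !rmorph_kfac.
rewrite !rmorphD /= !map_polyC /= ?map_polyC /= map_polyX z1 z2 !rmorph_nat polyC0 !addr0.
rewrite !kfac_Fp //.
rewrite -exprD addnn -mul2n; congr (_ * _).
rewrite (rmorph_Gpol (comp_poly ('X + a%:R))) /=.
by rewrite comp_polyX -polyC0 !comp_polyC.
Qed.

(** A polynomial in X^(p-1) has no linear term if p > 2. For p = 2 the even exponent helps: (X -
    1)^2 = X^2 - 1 in characteristic 2. *)
Lemma Ppol_coef1 : (p%:Z %| (Ppol p al1 al2 N e1 e2)`_1)%Z.
Proof.
have [c cE] := Ppol_Fp; rewrite intr_Fp0 -coef_map cE coefZ.
have [p2|p2] := boolP (p == 2).
  have -> : ('X^(p.-1) - 1) ^+ (2 * N) = (('X - 1) ^+ N) \Po 'X^2 :> {poly 'F_p}.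
    have two0 : 2%:R = 0 :> {poly 'F_p}.
      rewrite -polyC_natr (_ : 2%:R = 0 :> 'F_p) //.
      by rewrite -[2%N](eqP p2) pchar_Fp_0.
    rewrite [in p.-1](eqP p2) expr1 exprM rmorphXn /= rmorphB /= comp_polyX rmorph1.
    congr (_ ^+ N); have -> : ('X - 1) ^+ 2 = 'X^2 - 1 + 2%:R * (1 - 'X) :> {poly 'F_p}.
      by ring.
    by rewrite two0 mul0r addr0.
  by rewrite coef_comp_poly_Xn // mulr0.
have -> : ('X^(p.-1) - 1) ^+ (2 * N) =
    (('X - 1) ^+ (2 * N)) \Po 'X^(p.-1) :> {poly 'F_p}.
  by rewrite rmorphXn /= rmorphB /= comp_polyX rmorph1.
have := prime_gt1 p_pr => p1.
have p3 : (2 < p)%N by rewrite ltn_neqAle eq_sym p2.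
rewrite coef_comp_poly_Xn ?ifN ?mulr0 //; first by rewrite dvdn1; lia.
by case: (p) p3 => [|[]].
Qed.

(** Here p - 1 > 2, so a polynomial in X^(p-1) has no quadratic term; for p = 2, 3 that term may
    survive. *)
Lemma Ppol_coef2 : (4 < p)%N -> (p%:Z %| (Ppol p al1 al2 N e1 e2)`_2)%Z.
Proof.
move=> p4; have [c cE] := Ppol_Fp; rewrite intr_Fp0 -coef_map cE coefZ.
have -> : ('X^(p.-1) - 1) ^+ (2 * N) =
    (('X - 1) ^+ (2 * N)) \Po 'X^(p.-1) :> {poly 'F_p}.
  by rewrite rmorphXn /= rmorphB /= comp_polyX rmorph1.
rewrite coef_comp_poly_Xn; last by lia.
by rewrite ifN ?mulr0 // gtnNdvd //; lia.
Qed.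

End Coefficients.

(** The factor x - y is kept exact: it is cancelled when x, y are -e1, -e2, and supplies powers of p
    when x, y are multiples of p. *)
Lemma poly_int_diff (p : nat) (P : {poly int}) (x y : int) :
  (p%:Z %| x)%Z -> (p%:Z %| y)%Z ->
  exists w : int, P.[x] - P.[y] =
    (x - y) * (P`_1 + P`_2 * (x + y) + p%:Z ^+ 2 * w).
Proof.
move=> /dvdzP[u xE] /dvdzP[v yE].
pose T := drop_poly 3 P.
have PE z : P.[z] = P`_0 + P`_1 * z + P`_2 * z ^+ 2 + T.[z] * z ^+ 3.
  rewrite -{1}[P](poly_take_drop 3) hornerD hornerM hornerXn; congr (_ + _).
  rewrite horner_poly !big_ord_recr big_ord0 /=; ring.
have /factor_theorem[q qE] : root (T - T.[y]%:P) y.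
  by rewrite /root !hornerE subrr.
have {qE} TE : T.[x] = T.[y] + q.[x] * (x - y).
  have := congr1 (fun h => h.[x]) qE; rewrite !hornerE => <-; ring.
(* From T(x) x^3 - T(y) y^3 = T(x) (x^3 - y^3) + (T(x) - T(y)) y^3, with x = up and y = vp. *)
exists (T.[x] * (u ^+ 2 + u * v + v ^+ 2) + q.[x] * y * v ^+ 2).
rewrite !PE TE xE yE; ring.
Qed.

(** * Residues and the linear coefficient *)

Section Inverse.

Variables (p : nat) (p_pr : prime p).

Lemma ord_sub_ndvd (a m : nat) (z : int) : (a < p)%N -> (m < p)%N -> m != a ->
  (p%:Z %| z)%Z -> ~~ (p%:Z %| z + a%:R - m%:R)%Z.
Proof.
move=> ap mp ma pz; rewrite -addrA rpredDl //.
rewrite -eqz_mod_dvd !natz.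
by rewrite !modz_nat !modn_small // eqz_nat eq_sym.
Qed.

Lemma kfac_coprime (a : nat) (z : int) : (a < p)%N ->
  (p%:Z %| z)%Z -> coprime `|kfac p a z| p.
Proof.
move=> ap pz; rewrite /kfac; apply: (big_ind (fun n : int => coprime `|n| p)).
- by rewrite coprime1n.
- by move=> x y hx hy; rewrite abszM coprimeMl hx.
- move=> m ma; rewrite coprime_sym prime_coprime //.
  by have := ord_sub_ndvd ap (ltn_ord m) ma pz; rewrite dvdzE.
Qed.

Lemma Euler_int M (n : int) : coprime `|n| p ->
  (n ^+ totient (p ^ M) == 1 %[mod (p ^ M)%N])%Z.
Proof.
move=> cn; have q0 : (0 < p ^ M)%N by rewrite expn_gt0 prime_gt0.
pose k := `|(n %% (p ^ M)%N)%Z|%N.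
have kE : (n %% (p ^ M)%N)%Z = k.
  by rewrite /k gez0_abs // modz_ge0 // -lt0n.
rewrite -modzXm kE -[k%:Z]natz -natrX natz modz_nat.
have ck : coprime k (p ^ M).
  case: M {q0} @k kE => [|M] k kE; first by rewrite expn0 coprimen1.
  rewrite coprimeXr // coprime_sym prime_coprime //.
  have := prime_coprime `|n| p_pr; rewrite coprime_sym cn => /esym; apply: contra.
  move=> pk; have : (p%:Z %| n)%Z.
    rewrite (divz_eq n (p ^ M.+1)%N) kE rpredD //.
      by apply: dvdz_mull; rewrite dvdzE /= dvdn_exp.
  by rewrite dvdzE.
by rewrite (Euler_exp_totient ck) modz_nat.
Qed.

Lemma Zunit_coprime_int (n : int) : coprime `|n| p -> Zunit p n%:~R.
Proof.
move=> cn; apply: Zunit_int => //; apply: contraTneq cn => ->.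
by rewrite /coprime gcd0n; case: (p) p_pr => [|[]].
Qed.

Lemma pow_totient_inv M (n : int) : coprime `|n| p ->
  pcong p M (n ^+ (totient (p ^ M)).-1)%:~R n%:~R^-1.
Proof.
move=> cn; have nu := Zunit_coprime_int cn.
have := pcong_intr p_pr (Euler_int M cn).
rewrite -{1}[totient _]prednK ?totient_gt0 ?expn_gt0 ?prime_gt0 // exprSr.
rewrite rmorphM /= => h; have := pcongMr (ZunitV nu) h.
by rewrite mulfK ?mul1r // (Zunit_neq0 nu).
Qed.

Lemma Zloc_approx n x : x \in Zloc p -> exists m : int, pcong p n x m%:~R.
Proof.
case/ZlocP => u [v [v0 cv ->]]; exists (u * v ^+ (totient (p ^ n)).-1).
rewrite rmorphM /=; apply: pcongMl; first exact: Zloc_int.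
exact/pcong_sym/pow_totient_inv.
Qed.

(** Residue theorem for G(t) / prod_a (t + e1 - a)(t + e2 - a), whose numerator has degree at most
    2p - 2 and which has 2p simple poles. With true inverses in place of powers, the residues at the
    points a - e1 add up to P(-e1) / (e2 - e1), those at a - e2 to P(-e2) / (e1 - e2). Passing from
    inverses to powers is harmless modulo p^M. *)
Lemma Ppol_symm al1 al2 M (e1 e2 : int) : (al1 < p)%N -> (al2 < p)%N ->
  (p%:Z %| e1)%Z -> (p%:Z %| e2)%Z -> e1 != e2 ->
  ((p ^ M)%N%:Z %| (Ppol p al1 al2 (totient (p ^ M)).-1 e1 e2).[- e1] -
                   (Ppol p al1 al2 (totient (p ^ M)).-1 e1 e2).[- e2])%Z.
Proof.
move=> h1 h2 d1 d2 e12; set P := Ppol _ _ _ _ _ _.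
pose q (n : int) : rat := n%:~R.
have q_inj : injective q by apply: intr_inj.
pose G : {poly rat} := Gpol p al1 al2 (q e1)%:P (q e2)%:P 'X.
have GE (x : int) : G.[q x] = q (Gpol p al1 al2 e1 e2 x).
  by rewrite /G horner_Gpol hornerX /q rmorph_Gpol.
have Pcong (x : int) : (p%:Z %| x)%Z ->
    pcong p M (q P.[x]) (\sum_(a < p) q (Gpol p al1 al2 e1 e2 (x + a%:R)) /
                 (q (kfac p a (x + e1)) * q (kfac p a (x + e2)))).
  move=> dx; rewrite horner_Ppol /q rmorph_sum /=; apply: pcong_sum => a _.
  rewrite rmorphM /=; apply: pcongMl; first exact: Zloc_int.
  rewrite invfM rmorphM /=.
  have c1 : coprime `|kfac p a (x + e1)| p by apply: kfac_coprime; rewrite // rpredD.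
  have c2 : coprime `|kfac p a (x + e2)| p by apply: kfac_coprime; rewrite // rpredD.
  apply: pcongM; first exact: Zloc_int.
  - by rewrite ZunitV // Zunit_coprime_int.
  - exact: pow_totient_inv.
  - exact: pow_totient_inv.
(* The poles; [true] marks those coming from e1. *)
pose z (i : 'I_p * bool) : rat := q (i.1%:R - (if i.2 then e1 else e2)).
have z_inj : injective z.
  move=> [a b] [a' b'] /q_inj /= e.
  have ea : a = a'.
    apply/eqP; apply/negPn/negP => aa'.
    have pz : (p%:Z %| (if b' then e1 else e2) - (if b then e1 else e2))%Z.
      by rewrite rpredB //; [case: (b') | case: (b)].
    have := ord_sub_ndvd (ltn_ord a) (ltn_ord a') _ pz.
    rewrite eq_sym => /(_ aa') /negP; apply.
    suff -> : (if b' then e1 else e2) - (if b then e1 else e2) + a%:R - a'%:R = 0.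
      exact: dvdz0.
    have -> : a'%:R = (a%:R - (if b then e1 else e2)) + (if b' then e1 else e2).
      by rewrite e subrK.
    by ring.
  move: e; rewrite ea => /addrI /oppr_inj; case: b b' => [] [] // ee.
    by rewrite ee eqxx in e12.
  by rewrite ee eqxx in e12.
(* The poles with the same [b] contribute K_a(0). The others contribute a full product over m, which
   by [kfac_prod] is the difference of the two e's times K_a at that difference. *)
have wE a b : \prod_(j | j != (a, b)) (z (a, b) - z j) =
    q ((if b then e2 - e1 else e1 - e2) *
       (kfac p a 0 * kfac p a (if b then e2 - e1 else e1 - e2))).
  rewrite big_mkcond -(pair_bigA _ (fun m c =>
    if (m, c) != (a, b) then z (a, b) - z (m, c) else 1)) /=.
  under eq_bigr => m _ do rewrite big_bool.
  rewrite big_split /= mulrCA kfac_prod // /kfac /q rmorphM !rmorph_prod /=.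
  rewrite [X in _ = X * _]big_mkcond /=.
  case: b; [|rewrite mulrC]; congr (_ * _); apply: eq_bigr => m _.
  - rewrite xpair_eqE andbT -val_eqE /=; case: ifP => // _.
    by rewrite /z /q /= -rmorphB; congr (_%:~R); ring.
  - rewrite xpair_eqE andbF /= /z /q /= -rmorphB; congr (_%:~R); ring.
  - rewrite xpair_eqE andbT -val_eqE /=; case: ifP => // _.
    by rewrite /z /q /= -rmorphB; congr (_%:~R); ring.
  - rewrite xpair_eqE andbF /= /z /q /= -rmorphB; congr (_%:~R); ring.
have D0 : q (e2 - e1) != 0 by rewrite intr_eq0 subr_eq0 eq_sym.
have q0 : ((2 * p).-1 < #|{: 'I_p * bool}|)%N.
  by rewrite card_prod card_ord card_bool mulnC prednK // muln_gt0 prime_gt0.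
have := sum_residues z_inj (leq_ltn_trans (size_Gpol (q e1) (q e2) h1 h2) q0).
rewrite -/G -(pair_bigA _ (fun a b =>
   G.[z (a, b)] / \prod_(j | j != (a, b)) (z (a, b) - z j))) /=.
under eq_bigr => a _ do rewrite big_bool !wE.
rewrite big_split /=.
(* The exact rational counterpart of P(x) at x = -e1 (with e = e2 - e1) and at x = -e2 (with e = e1
   - e2): one of x + e1, x + e2 is 0, the other is e. *)
pose S (e : int) (x : int) := \sum_(a < p) q (Gpol p al1 al2 e1 e2 (x + a%:R)) /
                 (q (kfac p a 0) * q (kfac p a e)).
have SE (b : bool) (x e : int) : (if b then e1 else e2) = - x ->
    (if b then e2 - e1 else e1 - e2) = e ->
   \sum_(a < p) G.[z (a, b)] / q ((if b then e2 - e1 else e1 - e2) *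
       (kfac p a 0 * kfac p a (if b then e2 - e1 else e1 - e2))) =
   S e x / q e.
  move=> ex ->; rewrite mulr_suml; apply: eq_bigr => a _.
  rewrite /z /= ex opprK addrC GE /q !rmorphM /= !invfM; ring.
rewrite (SE true (- e1) (e2 - e1)) ?opprK // (SE false (- e2) (e1 - e2)) ?opprK //.
rewrite -[e1 - e2]opprB {2}/q rmorphN /= -/(q _) invrN mulrN => /eqP.
rewrite subr_eq0 => /eqP /(mulIf (invr_neq0 D0)) SS.
have Pc1 : pcong p M (q P.[- e1]) (S (e2 - e1) (- e1)).
  have := Pcong (- e1); rewrite rpredN => /(_ d1).
  by rewrite /S; under eq_bigr => a _ do rewrite addNr [- e1 + e2]addrC.
have Pc2 : pcong p M (q P.[- e2]) (S (- (e2 - e1)) (- e2)).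
  have := Pcong (- e2); rewrite rpredN => /(_ d2).
  rewrite /S opprB; under eq_bigr => a _ do
    rewrite addNr [- e2 + e1]addrC [q _ * q _]mulrC.
  by [].
rewrite dvdzE /=; apply: pcong_intr_dvd => //.
rewrite rmorphB /= -[0](subrr (S (e2 - e1) (- e1))); apply: pcongB => //.
by rewrite SS.
Qed.

(* Since e2 - e1 has valuation at most 3, P(-e1) = P(-e2) mod p^6 determines  *)
(* the linear coefficient of P modulo p^2.                                    *)
Lemma Ppol_const al1 al2 (e1 e2 x : int) : (al1 < p)%N -> (al2 < p)%N ->
  (p%:Z %| e1)%Z -> (p%:Z %| e2)%Z -> ~~ ((p ^ 4)%N%:Z %| e2 - e1)%Z ->
  (4 < p)%N -> (p%:Z %| x)%Z ->
  ((p ^ 3)%N%:Z %| (Ppol p al1 al2 (totient (p ^ 6)).-1 e1 e2).[x] -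
                   (Ppol p al1 al2 (totient (p ^ 6)).-1 e1 e2).[0])%Z.
Proof.
move=> h1 h2 d1 d2 v p4 dx; set P := Ppol _ _ _ _ _ _.
have e12 : e1 != e2.
  by apply: contraNneq v => ->; rewrite subrr dvdz0.
have := Ppol_symm 6 h1 h2 d1 d2 e12; rewrite -/P.
have dn1 : (p%:Z %| - e1)%Z by rewrite rpredN.
have dn2 : (p%:Z %| - e2)%Z by rewrite rpredN.
have [w ->] := poly_int_diff P dn1 dn2.
set S := (X in _ * X); rewrite opprK addrC => dS.
have {dS} dS : ((p ^ 2)%N%:Z %| S)%Z.
  have [->|S0] := eqVneq S 0; first exact: dvdz0.
  have D0 : e2 - e1 != 0 by rewrite subr_eq0 eq_sym.
  move: dS v; rewrite !dvdzE abszM !pfactor_dvdn ?muln_gt0 ?absz_gt0 ?D0 //.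
  rewrite lognM ?absz_gt0 // -ltnNge => dS v.
  rewrite -(leq_add2l (logn p `|e2 - e1|)) (leq_trans _ dS) //.
  by rewrite addn2 !ltnS ltnW.
have [c2 c2E] := dvdzP (Ppol_coef2 p_pr (totient (p ^ 6)).-1 h1 h2 d1 d2 p4).
have [u1 u1E] := dvdzP d1; have [u2 u2E] := dvdzP d2.
have [ux uxE] := dvdzP dx; have [s sE] := dvdzP dS.
have pX k : (p ^ k)%N%:Z = p%:Z ^+ k by rewrite -[LHS]natz natrX natz.
(* S equals P_1 - P_2 (e1 + e2) + p^2 w, and p divides both P_2 and e1 + e2. *)
have P1E : P`_1 = p%:Z ^+ 2 * (s - w + c2 * (u1 + u2)).
  have -> : P`_1 = S - P`_2 * (- e1 - e2) - p%:Z ^+ 2 * w by rewrite /S; ring.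
  by rewrite sE pX c2E u1E u2E; ring.
have [w' ->] := poly_int_diff P dx (dvdz0 _).
rewrite P1E c2E uxE pX; apply/dvdzP.
exists (ux * ((s - w + c2 * (u1 + u2)) + c2 * ux + w')); ring.
Qed.

(** The substitute for [Ppol_const] that also covers p = 2, 3: it rests on [Ppol_coef1] alone, which
    holds for every prime. *)
Lemma Ppol_congr al1 al2 N (e1 e2 x y : int) : (al1 < p)%N -> (al2 < p)%N ->
  (p%:Z %| e1)%Z -> (p%:Z %| e2)%Z -> (p%:Z %| x)%Z -> (p%:Z %| y)%Z ->
  exists w, (Ppol p al1 al2 N e1 e2).[x] - (Ppol p al1 al2 N e1 e2).[y] =
    (x - y) * (p%:Z * w).
Proof.
move=> h1 h2 d1 d2 dx dy; set P := Ppol _ _ _ _ _ _.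
have [c cE] := dvdzP (Ppol_coef1 p_pr N h1 h2 d1 d2).
have [w ->] := poly_int_diff P dx dy.
have [ux uxE] := dvdzP dx; have [uy uyE] := dvdzP dy.
exists (c + P`_2 * (ux + uy) + p%:Z * w).
by rewrite cE uxE uyE; ring.
Qed.

End Inverse.

(** * Quotients of shifted factorials *)

(** A summand of H is a product of two such factors ([H_poch]). Each is invariant under r -> 1 - r,
    so the image of r under the Dwork map matters only up to this reflection. *)
Definition poch (r : rat) (k : nat) : rat :=
  shifted_fact r k * shifted_fact (1 - r) k / (k`!)%:R ^+ 2.

(** The factors (u - e)(u + e) / u^2 with u prime to p; up to boundary factors, those with p
    dividing u make up [poch (e / p)]. *)
Definition Qprod (p : nat) (e : rat) (k : nat) : rat :=
  \prod_(u < k | ~~ (p %| u.+1)%N) (1 - e ^+ 2 / u.+1%:R ^+ 2).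

Lemma poch0 r : poch r 0 = 1.
Proof. by rewrite /poch /shifted_fact !big_ord0 fact0 expr1n invr1 !mulr1. Qed.

Lemma pochS r k : poch r k.+1 = poch r k * ((r + k%:R) * (1 - r + k%:R) / k.+1%:R ^+ 2).
Proof.
rewrite /poch /shifted_fact !big_ord_recr /= factS natrM.
have k0 : k.+1%:R != 0 :> rat by rewrite pnatr_eq0.
have f0 : (k`!)%:R != 0 :> rat by rewrite pnatr_eq0 -lt0n fact_gt0.
by move: (k.+1%:R) k0 ((k`!)%:R) f0 => K K0 f f0; field; rewrite f0 K0.
Qed.

Section ExactFormula.

Variables (p al : nat) (e : rat).
Hypotheses (p_gt0 : (0 < p)%N) (alp : (al < p)%N) (e_nint : e \isn't a Num.int).

Let Fk (k : nat) : rat := \prod_(m < p) (k%:R + e - m%:R).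

Let e_neq (n : int) : n%:~R + e != 0.
Proof.
apply: contraNneq e_nint => h; have -> : e = (- n)%:~R.
  by apply/eqP; rewrite rmorphN /= -addr_eq0 addrC h.
exact: intr_int.
Qed.

(** Replacing t by t + 1 trades one end factor for another in each of the two products. *)
Lemma gfac_step (t : rat) :
  gfac p al e (t + 1) * (t + 1 - e) * (t + 1 - p%:R + e) =
  gfac p al e t * (t + 1 + al%:R - e) * (t - al%:R + e).
Proof.
rewrite /gfac.
have E1 : \prod_(m < al) (t + 1 + m.+1%:R - e) * (t + 1 - e) =
          \prod_(m < al) (t + m.+1%:R - e) * (t + 1 + al%:R - e).
  transitivity (\prod_(m < al.+1) (t + m.+1%:R - e)); last first.
    by rewrite big_ord_recr /= -natr1; congr (_ * _); ring.
  rewrite big_ord_recl mulrC; congr (_ * _).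
  by apply: eq_bigr => m _; rewrite /= /bump /= add1n -[m.+2%:R]natr1; ring.
have E2 : \prod_(al.+1 <= j < p) (t + 1 - j%:R + e) * (t + 1 - p%:R + e) =
          \prod_(al.+1 <= j < p) (t - j%:R + e) * (t - al%:R + e).
  transitivity (\prod_(al.+1 <= j < p.+1) (t + 1 - j%:R + e)).
    by rewrite big_nat_recr.
  rewrite big_ltn // mulrC -natr1; congr (_ * _); last by ring.
  by rewrite big_add1; apply: eq_bigr => j _; rewrite -natr1; ring.
rewrite -!mulrA [_ * ((t + 1 - e) * _)]mulrCA [_ * ((_ + al%:R - e) * _)]mulrCA.
by rewrite E2 !mulrA E1.
Qed.

(** Induction on k, each side changing by an explicit factor. Multiplying by the full product [Fk]
    instead of dividing by [kfac] gives one formula for all residues of k modulo p. *)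
Lemma poch_block_raw k : poch (e - al%:R) k * Fk k =
  poch (e / p%:R) (k %/ p) * (-1) ^+ al * Qprod p e k * gfac p al e k%:R *
  ((k %/ p * p)%N%:R + e).
Proof.
elim: k => [|k IH].
  rewrite div0n !poch0 /Qprod big_ord0 !mul1r mulr1 mul0n add0r /Fk /gfac.
  rewrite -(big_mkord xpredT (fun m => 0%:R + e - m%:R)) big_ltn //.
  rewrite (@big_cat_nat _ _ _ al.+1) //= subr0 add0r mulrC mulrA; congr (_ * _ * _).
    have -> : (-1) ^+ al = \prod_(m < al) (-1) :> rat by rewrite prodr_const card_ord.
    rewrite big_add1 big_mkord -big_split /=.
    by apply: eq_bigr => m _; ring.
  by apply: eq_bigr => m _; ring.
have d0 : k%:R + 1 - p%:R + e != 0.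
  have := e_neq (k.+1%:Z - p%:Z); by rewrite rmorphB /= -!pmulrn -natr1.
have c0 : k%:R + 1 - e != 0.
  have := e_neq (- (k.+1%:Z)); rewrite rmorphN /= -!pmulrn -natr1.
  by apply: contraNneq => /eqP; rewrite subr_eq0 => /eqP ->; rewrite addNr.
have k0 : k%:R + 1 != 0 :> rat by rewrite natr1 pnatr_eq0.
have FS : Fk k.+1 * (k%:R + 1 - p%:R + e) = Fk k * (k%:R + 1 + e).
  rewrite /Fk -(prednK p_gt0) big_ord_recl big_ord_recr /= subr0 -!natr1.
  set P := \prod_(i < _) _; set Q := \prod_(i < _) _.
  have -> : P = Q.
    by apply: eq_bigr => m _; rewrite /= /bump /= add1n -!natr1; ring.
  by ring.
have gS := gfac_step k%:R.
(* The new factor for u = k + 1 goes into [Qprod] if p does not divide u; otherwise the block index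
   grows by one and the factor comes from [poch (e / p)] and the boundary term. *)
have BS : poch (e / p%:R) (k.+1 %/ p) * Qprod p e k.+1 * ((k.+1 %/ p * p)%N%:R + e) =
  poch (e / p%:R) (k %/ p) * Qprod p e k * ((k %/ p * p)%N%:R + e) *
  (k%:R + 1 + e) * (k%:R + 1 - e) / k.+1%:R ^+ 2.
  have K0 : k.+1%:R != 0 :> rat by rewrite pnatr_eq0.
  rewrite /Qprod [in LHS]big_mkcond big_ord_recr -big_mkcond /= divnS //.
  case: (boolP (p %| k.+1)%N) => [/dvdnP[b bE]|_] /=; last first.
    rewrite add0n natr1; move: (k.+1%:R) K0 => K K0; field.
    by rewrite K0.
  have kb : (k.+1 %/ p)%N = (k %/ p).+1.
    by rewrite divnS // bE dvdn_mull // add1n.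
  have {kb} bk : b = (k %/ p).+1 by rewrite -kb bE mulnK.
  rewrite add1n mulr1 pochS natr1 bE -bk bk !natrM.
  have b0 : (k %/ p).+1%:R != 0 :> rat by rewrite pnatr_eq0.
  have p0 : p%:R != 0 :> rat by rewrite pnatr_eq0 -lt0n.
  rewrite -natr1 in b0 *.
  by field; rewrite p0 b0.
have key (X F F' d c K K2i a b s Q Q' g g' C C' B B' : rat) :
    X * F = C * s * Q * g * B -> F' * d = F * K -> g' * c * d = g * b * a ->
    C' * Q' * B' = C * Q * B * K * c * K2i ->
  X * (a * b * K2i) * F' * d * c = C' * s * Q' * g' * B' * d * c.
  move=> h1 h2 h3 h4.
  transitivity (X * (F' * d) * (a * b * K2i * c)); first by ring.
  rewrite h2; transitivity (X * F * (K * a * b * K2i * c)); first by ring.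
  rewrite h1; transitivity (C' * Q' * B' * s * (g' * c * d)); last by ring.
  by rewrite h4 h3; ring.
rewrite pochS; apply: (mulIf d0); apply: (mulIf c0); apply: key BS; last first.
- rewrite -[k.+1%:R]natr1 gS; congr (_ * _ * _); first by ring.
  by ring.
- exact: FS.
- exact: IH.
Qed.

Lemma poch_block a b : (a < p)%N -> let k := (b * p + a)%N in
  kfac p a ((b * p)%N%:R + e) != 0 ->
  poch (e - al%:R) k = poch (e / p%:R) b *
    ((-1) ^+ al * Qprod p e k * (gfac p al e k%:R / kfac p a ((b * p)%N%:R + e))).
Proof.
move=> ap k K0; have := poch_block_raw k.
rewrite divnMDl // (divn_small ap) addn0.
have x0 : (b * p)%N%:R + e != 0 by have := e_neq (b * p)%N; rewrite -pmulrn.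
have -> : Fk k = ((b * p)%N%:R + e) * kfac p a ((b * p)%N%:R + e).
  by rewrite kfac_prod //; apply: eq_bigr => m _; rewrite natrD; ring.
move: K0 x0; set K := kfac _ _ _; set x := _ + e; clearbody K; move: x => x.
by move=> K0 x0 h; apply: (mulIf (mulf_neq0 x0 K0)); rewrite h; field.
Qed.

End ExactFormula.

(** * Congruences for the products [Qprod] *)

Section QCongruence.

Variables (p : nat) (p_pr : prime p).

Lemma Zunit_nat n : ~~ (p %| n)%N -> Zunit p n%:R.
Proof.
move=> pn; rewrite pmulrn; apply: Zunit_int.
  by rewrite -absz_eq0 /=; apply: contraNneq pn => ->; rewrite dvdn0.
by rewrite /= coprime_sym prime_coprime.
Qed.

Lemma pcong_natp : pcong p 1 p%:R 0.
Proof. by rewrite -[p%:R]mulr1; apply: (@pcong_pX p p_pr 1); rewrite ?rpred1. Qed.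

Variables (e : rat) (e0 : pcong p 1 e 0).

Let eZ : e \in Zloc p.
Proof. by rewrite (pcong_int p_pr e0) rpred0. Qed.

Let e2 : pcong p 2 (e ^+ 2) 0.
Proof. exact: (@pcong_mul0 p 1 1). Qed.

Let Qprodac (u : nat) : rat := 1 - e ^+ 2 / u%:R ^+ 2.

Let Qprodac1 u : ~~ (p %| u)%N -> pcong p 2 (Qprodac u) 1.
Proof.
move=> pu; rewrite -[1]subr0; apply: pcongB => //.
rewrite -[0](mul0r (u%:R ^+ 2)^-1); apply: pcongMr => //.
by rewrite -exprVn rpredX // ZunitV // Zunit_nat.
Qed.

Let QprodacZ u : ~~ (p %| u)%N -> Qprodac u \in Zloc p.
Proof. by move=> pu; rewrite (pcong_int p_pr (Qprodac1 pu)) rpred1. Qed.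

(** The factor e^2 brings p^2, and the difference of the inverse squares brings p. *)
Let Qprodac_shift u v : ~~ (p %| u)%N -> v = (p + u)%N -> pcong p 3 (Qprodac v) (Qprodac u).
Proof.
move=> pu ->; apply: pcongB => //; rewrite -pcong_sub0.
have pv : ~~ (p %| p + u)%N by rewrite dvdn_addr.
rewrite -mulrBr; apply: (@pcong_mul0 p 2 1) => //; rewrite pcong_sub0.
rewrite -!exprVn; apply: pcong_exp => //; first by rewrite ZunitV // Zunit_nat.
apply: pcongV => //; try exact: Zunit_nat.
rewrite natrD -[X in pcong _ _ _ X]add0r; apply: pcongD => //.
exact: pcong_natp.
Qed.

Lemma Qprod_Zloc k : Qprod p e k \in Zloc p.
Proof. by apply: rpred_prod => u pu; apply: QprodacZ. Qed.

Lemma Qprod_cong1 k : pcong p 2 (Qprod p e k) 1.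
Proof.
apply: pcong_trans (@pcong_prod p p_pr 2 _ _ _ _ (fun=> 1) _ _) _ => [u|u|].
- exact: QprodacZ.
- exact: Qprodac1.
- by rewrite big1.
Qed.

Lemma Qprod_shift n : pcong p 3 (Qprod p e (p + n)) (Qprod p e p * Qprod p e n).
Proof.
rewrite {1}/Qprod big_split_ord /=; apply: pcongM => //; try exact: Qprod_Zloc.
rewrite /Qprod; under eq_bigl => u do rewrite -addnS dvdn_addr //.
apply: pcong_prod => // u pu.
  by apply: QprodacZ; rewrite -addnS dvdn_addr.
by apply: Qprodac_shift; rewrite ?addnS.
Qed.

Lemma Qprod_block b a : pcong p 3 (Qprod p e (b * p + a)) (Qprod p e p ^+ b * Qprod p e a).
Proof.
elim: b => [|b IH]; first by rewrite mul0n add0n expr0 mul1r.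
rewrite mulSn -addnA exprS -mulrA; apply: pcong_trans (Qprod_shift _) _.
by apply: pcongMl => //; apply: Qprod_Zloc.
Qed.

(** By Fermat, 1/u^2 = u^(p-3) modulo p, and the power sum over ['F_p] with exponent 0 < p - 3 < p -
    1 vanishes. *)
Lemma sum_inv_sqr : (4 < p)%N ->
  pcong p 1 (\sum_(u < p | ~~ (p %| u.+1)%N) u.+1%:R ^- 2) 0.
Proof.
move=> p4.
have : pcong p 1 (\sum_(u < p | ~~ (p %| u.+1)%N) u.+1%:R ^- 2)
                 (\sum_(u < p | ~~ (p %| u.+1)%N) u.+1%:R ^+ (p - 3)).
  apply: pcong_sum => u pu; apply: pcong_sym.
  have U := Zunit_nat pu; have U0 := Zunit_neq0 U.
  have -> : u.+1%:R ^+ (p - 3) = u.+1%:R ^- 2 * u.+1%:R ^+ (p.-1) :> rat.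
    have -> : p.-1 = (2 + (p - 3))%N by lia.
    by rewrite exprD mulKf // expf_neq0.
  rewrite -[X in pcong _ _ _ X]mulr1; apply: pcongMl.
    by rewrite -exprVn rpredX // ZunitV.
  have cu : coprime `|u.+1%:Z| p by rewrite /= coprime_sym prime_coprime.
  have := pcong_intr p_pr (@Euler_int p p_pr 1 _ cu).
  by rewrite expn1 totient_prime // rmorphXn /= -pmulrn.
move=> h; apply: pcong_trans h _.
pose S : int := \sum_(u < p | ~~ (p %| u.+1)%N) u.+1%:Z ^+ (p - 3).
have -> : \sum_(u < p | ~~ (p %| u.+1)%N) u.+1%:R ^+ (p - 3) = S%:~R :> rat.
  by rewrite /S rmorph_sum /=; apply: eq_bigr => u _; rewrite rmorphXn /= -pmulrn.
apply: (@pcong_intr p p_pr 1 S 0); rewrite eqz_mod_dvd subr0 expn1.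
rewrite intr_Fp0 // /S rmorph_sum /=.
have -> : \sum_(u < p | ~~ (p %| u.+1)%N) (u.+1%:Z ^+ (p - 3))%:~R =
  \sum_(u < p) (u%:R + 1) ^+ (p - 3) :> 'F_p.
  rewrite big_mkcond; apply: eq_bigr => u _; rewrite rmorphXn /= -pmulrn natr1.
  case: ifP => // /negbFE; rewrite (dvdn_pcharf (pchar_Fp p_pr)) => /eqP ->.
  by rewrite expr0n; case: eqP => //; lia.
rewrite -(big_Fp p_pr _ (fun x : 'F_p => (x + 1) ^+ (p - 3))).
pose h1 : {poly 'F_p} := ('X - (-1)%:P) ^+ (p - 3).
have -> : \sum_(x : 'F_p) (x + 1) ^+ (p - 3) = \sum_(x : 'F_p) h1.[x].
  by apply: eq_bigr => x _; rewrite horner_exp hornerXsubC opprK.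
apply/eqP; apply: sum_Fp_small => //.
rewrite size_exp_XsubC; lia.
Qed.

(** Terms of the expansion beyond the linear one carry e^4, hence p^4; the linear one is e^2 times
    the sum in [sum_inv_sqr]. *)
Lemma Qprod_p_cong1 : (4 < p)%N -> pcong p 3 (Qprod p e p) 1.
Proof.
move=> p4.
have expand (I : Type) (r : seq I) (P : pred I) (t : I -> rat) :
    (forall i, P i -> t i \in Zloc p) ->
  pcong p 3 (\prod_(i <- r | P i) (1 - e ^+ 2 * t i))
            (1 - e ^+ 2 * \sum_(i <- r | P i) t i).
  move=> ti; elim: r => [|i r IH]; first by rewrite !big_nil mulr0 subr0.
  rewrite !big_cons; case: ifP => // Pi.
  have tZ : \sum_(j <- r | P j) t j \in Zloc p by rewrite rpred_sum.
  set T := \sum_(j <- r | P j) t j in IH tZ *.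
  apply: pcong_trans (pcongMl _ IH) _.
    by rewrite rpredB ?rpred1 // rpredM ?rpredX ?ti.
  rewrite -pcong_sub0; have -> : (1 - e ^+ 2 * t i) * (1 - e ^+ 2 * T) -
     (1 - e ^+ 2 * (t i + T)) = e ^+ 2 * e ^+ 2 * (t i * T) by ring.
  rewrite -[0](mul0r (t i * T)); apply: pcongMr; first by rewrite rpredM ?ti.
  exact: (@pcong_leq p p_pr 3 (2 + 2)) (@pcong_mul0 p 2 2 _ _ e2 e2).
have := @expand _ (index_enum 'I_p) (fun u => ~~ (p %| u.+1)%N)
  (fun u => u.+1%:R ^- 2).
move=> /(_ _)/pcong_trans; apply => [u pu|].
  by rewrite -exprVn rpredX // ZunitV // Zunit_nat.
rewrite -[X in pcong _ _ _ X]subr0; apply: pcongB => //.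
exact: (@pcong_mul0 p 2 1) e2 (sum_inv_sqr p4).
Qed.

End QCongruence.

(** * Block sums modulo p^2 and p^3 *)

Section LocalFactors.

Variables (p : nat) (p_pr : prime p).

Lemma kfac_unit a z : (a < p)%N -> pcong p 1 z 0 -> Zunit p (kfac p a z).
Proof.
move=> ap z0; apply: Zunit_prod => m ma.
have nd := ord_sub_ndvd ap (ltn_ord m) ma (dvdz0 p).
apply: (@Zunit_cong p p_pr 1 (0 + a%:R - (m : nat)%:R : int)%:~R) => //; last first.
  apply: (Zunit_coprime_int p_pr); rewrite coprime_sym prime_coprime //.
rewrite rmorphB rmorphD /= !rmorph_nat rmorph0; apply: pcongB => //.
by apply: pcongD => //; apply: pcong_sym.
Qed.

Lemma kfac_cong n a z z' : z \in Zloc p -> pcong p n z z' ->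
  pcong p n (kfac p a z) (kfac p a z').
Proof.
move=> zZ h; apply: pcong_prod => // m _.
  by rewrite !(rpredB, rpredD) ?Zloc_nat.
by apply: pcongB => //; apply: pcongD.
Qed.

Lemma gfac_Zloc al e t : e \in Zloc p -> t \in Zloc p -> gfac p al e t \in Zloc p.
Proof.
move=> eZ tZ; apply: rpredM; apply: rpred_prod => m _.
  by rewrite rpredB // rpredD ?Zloc_nat.
by rewrite rpredD // rpredB ?Zloc_nat.
Qed.

Lemma gfac_cong n al e e' t t' : e \in Zloc p -> t \in Zloc p ->
  pcong p n e e' -> pcong p n t t' -> pcong p n (gfac p al e t) (gfac p al e' t').
Proof.
move=> eZ tZ he ht.
have e'Z : e' \in Zloc p by rewrite -(pcong_int p_pr he).
have t'Z : t' \in Zloc p by rewrite -(pcong_int p_pr ht).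
apply: pcongM.
- by apply: rpred_prod => m _; rewrite rpredB // rpredD ?Zloc_nat.
- by apply: rpred_prod => m _; rewrite rpredD // rpredB ?Zloc_nat.
- apply: pcong_prod => // m _; first by rewrite rpredB // rpredD ?Zloc_nat.
  by apply: pcongB => //; apply: pcongD.
- apply: pcong_prod => // m _; first by rewrite rpredD // rpredB ?Zloc_nat.
  by apply: pcongD => //; apply: pcongB.
Qed.

Lemma pcong_mulp b : pcong p 1 (b * p)%N%:R 0.
Proof.
rewrite natrM -[0](mulr0 b%:R); apply: pcongMl; first exact: Zloc_nat.
exact: pcong_natp.
Qed.

Definition tfac (al : nat) (e : rat) (a b : nat) : rat :=
  gfac p al e (b * p + a)%N%:R / kfac p a ((b * p)%N%:R + e).

Section OneFactor.

Variables (al : nat) (e : rat) (e0 : pcong p 1 e 0).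

Let eZ : e \in Zloc p.
Proof. by rewrite (pcong_int p_pr e0) rpred0. Qed.

Let x0 b : pcong p 1 ((b * p)%N%:R + e) 0.
Proof. by rewrite -[0]addr0; apply: pcongD => //; apply: pcong_mulp. Qed.

Lemma tfac_Zloc a b : (a < p)%N -> tfac al e a b \in Zloc p.
Proof.
move=> ap; rewrite rpredM ?gfac_Zloc ?Zloc_nat //.
by rewrite ZunitV // kfac_unit.
Qed.

Lemma tfac_cong1 a b : (a < p)%N -> pcong p 1 (tfac al e a b) (tfac al e a 0).
Proof.
move=> ap; have K0 := kfac_unit ap (x0 0); have Kb := kfac_unit ap (x0 b).
apply: pcongM; rewrite ?gfac_Zloc ?Zloc_nat ?(ZunitV K0) //.
  apply: gfac_cong; rewrite ?Zloc_nat // natrD mul0n add0n.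
  rewrite -[X in pcong _ _ _ X]add0r; apply: pcongD => //; exact: pcong_mulp.
apply: pcongV => //; apply: kfac_cong; first by rewrite rpredD ?Zloc_nat.
by apply: pcongD => //; rewrite mul0n; apply: pcong_mulp.
Qed.

(** Brings the factor to the form used in [Ppol]: e becomes an integer, to precision p^n, and the
    inverse of K a power, to precision p^N. *)
Lemma tfac_int (n N a b : nat) (h : int) : (a < p)%N -> (0 < n)%N -> (n <= N)%N ->
  pcong p n e h%:~R ->
  pcong p n (tfac al e a b)
    (gfac p al h ((b * p)%N%:Z + a%:R) *
     kfac p a ((b * p)%N%:Z + h) ^+ (totient (p ^ N)).-1)%:~R.
Proof.
move=> ap n0 nN he.
have ph : (p%:Z %| h)%Z.
  rewrite dvdzE /= -[p in (p %| _)%N]expn1; apply: pcong_intr_dvd => //.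
  by apply: pcong_trans e0; apply/pcong_sym/(pcong_leq p_pr n0).
have px : (p%:Z %| (b * p)%N%:Z)%Z by rewrite dvdzE /= dvdn_mull.
have tE : ((b * p)%N%:Z + a%:R)%:~R = (b * p + a)%N%:R :> rat.
  by rewrite natz -PoszD -pmulrn.
rewrite rmorphM /= rmorph_gfac /= tE; apply: pcongM.
- by rewrite gfac_Zloc ?Zloc_nat.
- exact: Zloc_int.
- by apply: gfac_cong => //; rewrite Zloc_nat.
set K := kfac p a (_ + h).
have cK : coprime `|K| p by apply: kfac_coprime => //; rewrite rpredD.
apply: pcong_trans (pcong_sym (pcong_leq p_pr nN (pow_totient_inv p_pr N cK))).
apply: pcongV; rewrite ?kfac_unit ?Zunit_coprime_int //.
rewrite /K rmorph_kfac rmorphD /= -pmulrn; apply: kfac_cong.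
  by rewrite rpredD ?Zloc_nat.
exact: pcongD.
Qed.

End OneFactor.

Section TwoFactors.

Variables (al1 al2 : nat) (e1 e2 : rat).
Hypotheses (h1 : (al1 < p)%N) (h2 : (al2 < p)%N).
Hypotheses (d1 : pcong p 1 e1 0) (d2 : pcong p 1 e2 0).

Definition tfac_sum (b : nat) : rat := \sum_(a < p) tfac al1 e1 a b * tfac al2 e2 a b.

(* The two integer approximations are taken in [0, p^3[ and [p^3, 2 p^3[, so *)
(* that they differ and p^4 does not divide their difference.                *)
Lemma tfac_sum_poly : exists n1 n2 : int,
  [/\ (p%:Z %| n1)%Z, (p%:Z %| n2)%Z, ~~ ((p ^ 4)%N%:Z %| n2 - n1)%Z &
   forall b, pcong p 3 (tfac_sum b)
    ((Ppol p al1 al2 (totient (p ^ 6)).-1 n1 n2).[(b * p)%N%:Z])%:~R].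
Proof.
have p1 := prime_gt1 p_pr.
have q0 : (0 < p ^ 3)%N by rewrite expn_gt0 prime_gt0.
have e1Z : e1 \in Zloc p by rewrite (pcong_int p_pr d1) rpred0.
have e2Z : e2 \in Zloc p by rewrite (pcong_int p_pr d2) rpred0.
have [m1 m1E] := Zloc_approx p_pr 3 e1Z.
have [m2 m2E] := Zloc_approx p_pr 3 e2Z.
pose q : int := (p ^ 3)%N.
have q0' : q != 0 by rewrite -lt0n.
pose n1 := (m1 %% q)%Z; pose n2 := q + (m2 %% q)%Z.
have E1 : pcong p 3 e1 n1%:~R.
  by apply: pcong_trans m1E _; apply: pcong_intr => //; rewrite modz_mod.
have E2 : pcong p 3 e2 n2%:~R.
  by apply: pcong_trans m2E _; apply: pcong_intr => //; rewrite modzDl modz_mod.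
have dv (e : rat) (n : int) : pcong p 1 e 0 -> pcong p 3 e n%:~R -> (p%:Z %| n)%Z.
  move=> e0 en; rewrite dvdzE /= -[p in (p %| _)%N]expn1; apply: pcong_intr_dvd => //.
  by apply: pcong_trans e0; apply/pcong_sym/(pcong_leq p_pr _ en).
exists n1, n2; split; [exact: dv E1 | exact: dv E2 | |].
  have b1 : 0 <= n1 < q by rewrite modz_ge0 //= ltz_pmod.
  have b2 : q <= n2 < 2 * q.
    by rewrite /n2 lerDl modz_ge0 //= mulrDl !mul1r ltrD2l ltz_pmod.
  have Dgt : 0 < n2 - n1 by lia.
  have Dlt : n2 - n1 < (p ^ 4)%N%:Z.
    have : 2 * q <= (p ^ 4)%N%:Z by rewrite expnS PoszM ler_wpM2r.
    lia.
  rewrite dvdzE /= gtnNdvd //; first by rewrite absz_gt0 gt_eqF.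
  by rewrite -ltz_nat gez0_abs // ltW.
move=> b; rewrite horner_Ppol rmorph_sum /=; apply: pcong_sum => a _.
have T1 := @tfac_int al1 e1 d1 3 6 a b n1 (ltn_ord a) isT isT E1.
have T2 := @tfac_int al2 e2 d2 3 6 a b n2 (ltn_ord a) isT isT E2.
rewrite /Gpol [X in pcong _ _ _ X%:~R]mulrACA rmorphM /=; apply: pcongM => //.
- exact: tfac_Zloc.
- exact: Zloc_int.
Qed.

(** The difference of the arguments bp and b'p is divisible by p^2, and [Ppol_congr] supplies one
    more p. *)
Lemma tfac_sum_cong3 b b' : (b = b' %[mod p])%N -> pcong p 3 (tfac_sum b) (tfac_sum b').
Proof.
have [n1 [n2 [dn1 dn2 _ tE]]] := tfac_sum_poly.
wlog bb : b b' / (b' <= b)%N => [W e|e].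
  by case/orP: (leq_total b' b) => h; [apply: W | apply/pcong_sym/W].
apply: pcong_trans (tE b) _; apply: pcong_sym; apply: pcong_trans (tE b') _.
apply: pcong_sym; rewrite -pcong_sub0 -rmorphB /=.
have px c : (p%:Z %| (c * p)%N%:Z)%Z by rewrite dvdzE /= dvdn_mull.
have [w ->] := Ppol_congr p_pr (totient (p ^ 6)).-1 h1 h2 dn1 dn2 (px b) (px b').
have /dvdnP[c cE] : (p %| b - b')%N by rewrite -eqn_mod_dvd //; apply/eqP.
have -> : (b * p)%N%:Z - (b' * p)%N%:Z = c%:Z * p%:Z * p%:Z.
  by rewrite -{1}(subnK bb) cE !PoszM PoszD PoszM; ring.
have -> : (c%:Z * p%:Z * p%:Z * (p%:Z * w))%:~R = p%:R ^+ 3 * (c%:R * w%:~R) :> rat.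
  by rewrite !rmorphM /= -!pmulrn; ring.
by apply: pcong_pX => //; rewrite rpredM ?Zloc_nat ?Zloc_int.
Qed.

Lemma tfac_sum_cong2 b : pcong p 2 (tfac_sum b) (tfac_sum 0).
Proof.
have [n1 [n2 [dn1 dn2 _ tE]]] := tfac_sum_poly.
have {}tE c := pcong_leq p_pr (isT : (2 <= 3)%N) (tE c).
apply: pcong_trans (tE b) _; apply: pcong_sym; apply: pcong_trans (tE 0%N) _.
apply: pcong_sym; rewrite -pcong_sub0 -rmorphB /=.
have px c : (p%:Z %| (c * p)%N%:Z)%Z by rewrite dvdzE /= dvdn_mull.
have [w ->] := Ppol_congr p_pr (totient (p ^ 6)).-1 h1 h2 dn1 dn2 (px b) (px 0%N).
have -> : (((b * p)%N%:Z - (0 * p)%N%:Z) * (p%:Z * w))%:~R =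
    p%:R ^+ 2 * (b%:R * w%:~R) :> rat.
  by rewrite mul0n subr0 PoszM !rmorphM /= -!pmulrn; ring.
by apply: pcong_pX => //; rewrite rpredM ?Zloc_nat ?Zloc_int.
Qed.

Lemma tfac_sum_const b : (4 < p)%N -> pcong p 3 (tfac_sum b) (tfac_sum 0).
Proof.
move=> p4; have [n1 [n2 [dn1 dn2 v tE]]] := tfac_sum_poly.
apply: pcong_trans (tE b) _; apply: pcong_sym; apply: pcong_trans (tE 0%N) _.
apply: pcong_sym; apply: pcong_intr => //; rewrite eqz_mod_dvd mul0n.
by apply: Ppol_const => //; rewrite dvdzE /= dvdn_mull.
Qed.

Let B : rat := Qprod p e1 p * Qprod p e2 p.

Definition block_sum (b : nat) : rat := \sum_(a < p)
  Qprod p e1 (b * p + a) * Qprod p e2 (b * p + a) * (tfac al1 e1 a b * tfac al2 e2 a b).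

Let QQZ k : Qprod p e1 k * Qprod p e2 k \in Zloc p.
Proof. by rewrite rpredM ?Qprod_Zloc. Qed.

Let QQ1 k : pcong p 2 (Qprod p e1 k * Qprod p e2 k) 1.
Proof.
by rewrite -[1]mulr1; apply: pcongM; rewrite ?Qprod_Zloc ?rpred1 //; apply: Qprod_cong1.
Qed.

Let TTZ a b : (a < p)%N -> tfac al1 e1 a b * tfac al2 e2 a b \in Zloc p.
Proof. by move=> ap; rewrite rpredM ?tfac_Zloc. Qed.

Lemma tfac2_cong1 a b : (a < p)%N ->
  pcong p 1 (tfac al1 e1 a b * tfac al2 e2 a b) (tfac al1 e1 a 0 * tfac al2 e2 a 0).
Proof. by move=> ap; apply: pcongM; rewrite ?tfac_Zloc //; apply: tfac_cong1. Qed.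

Let C : rat := \sum_(a < p)
  (Qprod p e1 a * Qprod p e2 a - 1) * (tfac al1 e1 a 0 * tfac al2 e2 a 0).

Let BZ b : B ^+ b \in Zloc p.
Proof. by rewrite rpredX // QQZ. Qed.

Let tfac_sumZ b : tfac_sum b \in Zloc p.
Proof. by rewrite rpred_sum // => a _; rewrite TTZ. Qed.

Let CZ : C \in Zloc p.
Proof. by rewrite rpred_sum // => a _; rewrite rpredM ?TTZ // rpredB ?QQZ ?rpred1. Qed.

(** With t_b the product of the two [tfac], Q t_b = t_b + (Q - 1) t_0 + (Q - 1)(t_b - t_0), and the
    last term is divisible by p^2 p. All dependence on b is thus in B^b and [tfac_sum b]. *)
Let block_sum_shape b : pcong p 3 (block_sum b) (B ^+ b * (tfac_sum b + C)).
Proof.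
rewrite -big_split mulr_sumr /=; apply: pcong_sum => a _; have ap := ltn_ord a.
set t := tfac al1 e1 a b * _; set t0 := tfac al1 e1 a 0 * _.
have tZ : t \in Zloc p by rewrite TTZ.
apply: (@pcong_trans p 3 (B ^+ b * ((Qprod p e1 a * Qprod p e2 a) * t))).
  rewrite mulrA; apply: pcongMr => //.
  by rewrite exprMn mulrACA; apply: pcongM; rewrite ?Qprod_Zloc ?rpredM ?rpredX ?Qprod_Zloc //;
     apply: Qprod_block.
apply: pcongMl => //; rewrite -pcong_sub0.
set Q := Qprod p e1 a * _; have -> : Q * t - (t + (Q - 1) * t0) = (Q - 1) * (t - t0) by ring.
by apply: (@pcong_mul0 p 2 1); rewrite pcong_sub0 ?QQ1 ?tfac2_cong1.
Qed.

Let B1 b : pcong p 2 (B ^+ b) 1.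
Proof. rewrite -(expr1n rat b); apply: (pcong_exp p_pr); [exact: QQZ | exact: QQ1]. Qed.

Lemma block_sum_Zloc b : block_sum b \in Zloc p.
Proof. by rewrite rpred_sum // => a _; rewrite rpredM ?QQZ ?TTZ. Qed.

Lemma block_sum_cong2 b : pcong p 2 (block_sum b) (block_sum 0).
Proof.
have sh c := pcong_leq p_pr (isT : (2 <= 3)%N) (block_sum_shape c).
apply: pcong_trans (sh b) _; apply: pcong_sym; apply: pcong_trans (sh 0%N) _.
apply: pcong_sym; apply: pcongM => //; first by rewrite rpredD.
by apply: pcongD => //; apply: tfac_sum_cong2.
Qed.

(** As B = 1 modulo p^2, B^p = 1 modulo p^3, so B^b also depends only on b modulo p. *)
Lemma block_sum_cong3 b b' : (b = b' %[mod p])%N -> pcong p 3 (block_sum b) (block_sum b').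
Proof.
move=> e; apply: pcong_trans (block_sum_shape b) _; apply: pcong_sym.
apply: pcong_trans (block_sum_shape b') _; apply: pcong_sym.
apply: pcongM; [by [] | by rewrite rpredD | | by apply: pcongD => //; apply: tfac_sum_cong3].
have Bp : pcong p 3 (B ^+ p) 1.
  have [z zZ zE] := pcongP p_pr _ _ _ (QQ1 p); rewrite -/B in zE.
  have -> : B = 1 + p%:R ^+ 2 * z by rewrite -zE addrC subrK.
  set y := _ * z; rewrite -pcong_sub0.
  have -> : (1 + y) ^+ p - 1 = (1 + y) ^+ p - 1 ^+ p by rewrite expr1n.
  rewrite subrXX addrAC subrr add0r /y.
  apply: (@pcong_mul0 p 2 1); first exact: pcong_pX.
  apply: (@pcong_trans p 1 (\sum_(i < p) 1)).
    apply: pcong_sum => i _; rewrite expr1n mulr1.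
    rewrite -[X in pcong _ _ _ X](expr1n rat (p.-1 - i)).
    have y0 : pcong p 1 (p%:R ^+ 2 * z) 0.
      by apply: (@pcong_leq p p_pr 1 2) => //; apply: pcong_pX.
    apply: (pcong_exp p_pr).
      by rewrite rpredD ?rpred1 // (pcong_int p_pr y0) rpred0.
    by rewrite -[X in pcong _ _ _ X]addr0; apply: pcongD.
  by rewrite sumr_const card_ord; apply: pcong_natp.
have Bc c : pcong p 3 (B ^+ c) (B ^+ (c %% p)).
  rewrite {1}(divn_eq c p) exprD mulnC exprM -[X in pcong _ _ _ X]mul1r.
  apply: pcongM; [by rewrite rpredX // BZ | exact: BZ | | by []].
  rewrite -[X in pcong _ _ _ X](expr1n rat (c %/ p)).
  by apply: pcong_exp => //; apply: BZ.
by apply: pcong_trans (Bc b) _; rewrite e; apply: pcong_sym.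
Qed.

Lemma block_sum_const b : (4 < p)%N -> pcong p 3 (block_sum b) (block_sum 0).
Proof.
move=> p4; apply: pcong_trans (block_sum_shape b) _; apply: pcong_sym.
apply: pcong_trans (block_sum_shape 0) _; apply: pcong_sym.
apply: pcongM; [by [] | by rewrite rpredD | | by apply: pcongD => //; apply: tfac_sum_const].
rewrite expr0 -[X in pcong _ _ _ X](expr1n rat b).
apply: pcong_exp => //; first exact: QQZ.
by rewrite -[1]mulr1; apply: pcongM; rewrite ?Qprod_Zloc ?rpred1 //; apply: Qprod_p_cong1.
Qed.

End TwoFactors.

End LocalFactors.

(** * Multiplicativity of H modulo p^3 *)

Lemma poch_sym r k : poch (1 - r) k = poch r k.
Proof. by rewrite /poch subKr [X in X / _]mulrC. Qed.

Lemma H_poch r1 r2 N : H r1 r2 N = \sum_(k < N) poch r1 k * poch r2 k.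
Proof.
apply: eq_bigr => k _; rewrite /poch mulf_div -exprD; congr (_ / _).
by rewrite !mulrA.
Qed.

Lemma sum_ord_mul (V : nmodType) (m p : nat) (F : nat -> V) :
  \sum_(k < m * p) F k = \sum_(b < m) \sum_(a < p) F (b * p + a)%N.
Proof.
elim: m => [|m IH]; first by rewrite mul0n !big_ord0.
rewrite big_ord_recr -IH /= -(big_mkord xpredT F) mulSn addnC.
by rewrite big_mkord big_split_ord.
Qed.

Section Dwork.

Variables (p : nat) (p_pr : prime p) (r1 r2 : rat) (al1 al2 : nat).
Hypotheses (h1 : (al1 < p)%N) (h2 : (al2 < p)%N).
Hypotheses (d1 : pcong p 1 (r1 + al1%:R) 0) (d2 : pcong p 1 (r2 + al2%:R) 0).
Hypotheses (i1 : r1 \isn't a Num.int) (i2 : r2 \isn't a Num.int).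
(** Only the product has to be preserved: the Dwork map may swap the two parameters or reflect
    them. *)
Hypothesis dwork_perm : forall k,
  poch ((r1 + al1%:R) / p%:R) k * poch ((r2 + al2%:R) / p%:R) k = poch r1 k * poch r2 k.

Let A (k : nat) : rat := poch r1 k * poch r2 k.
Let e1 := r1 + al1%:R.
Let e2 := r2 + al2%:R.
Let f (b : nat) : rat := (-1) ^+ (al1 + al2) * block_sum p al1 al2 e1 e2 b.

Let nint_shift (r : rat) (al : nat) : r \isn't a Num.int -> r + al%:R \isn't a Num.int.
Proof. by apply: contra => h; rewrite -(addrK al%:R r) rpredB // natr_int. Qed.

Let x0 (e : rat) b : pcong p 1 e 0 -> pcong p 1 ((b * p)%N%:R + e) 0.
Proof. by move=> h; rewrite -[0]addr0; apply: pcongD => //; apply: pcong_mulp. Qed.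

Let A_block a b : (a < p)%N -> A (b * p + a) = A b * ((-1) ^+ (al1 + al2) *
   (Qprod p e1 (b * p + a) * Qprod p e2 (b * p + a) *
    (tfac p al1 e1 a b * tfac p al2 e2 a b))).
Proof.
move=> ap; have p0 := prime_gt0 p_pr.
have K1 := Zunit_neq0 (kfac_unit p_pr ap (x0 b d1)).
have K2 := Zunit_neq0 (kfac_unit p_pr ap (x0 b d2)).
have E1 := poch_block p0 h1 (nint_shift al1 i1) ap K1.
have E2 := poch_block p0 h2 (nint_shift al2 i2) ap K2.
rewrite !addrK in E1 E2; rewrite {1}/A E1 E2 /A -(dwork_perm b) exprD /tfac /e1 /e2.
by ring.
Qed.

Let sum_A_block b : \sum_(a < p) A (b * p + a) = A b * f b.
Proof. by rewrite /f !mulr_sumr; apply: eq_bigr => a _; rewrite A_block // mulrA. Qed.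

Let sgnZ : (-1) ^+ (al1 + al2) \in Zloc p.
Proof. by rewrite rpredX // rpredN rpred1. Qed.

Let fZ b : f b \in Zloc p.
Proof. by rewrite rpredM // block_sum_Zloc. Qed.

Let TZ a b : (a < p)%N -> (-1) ^+ (al1 + al2) *
   (Qprod p e1 (b * p + a) * Qprod p e2 (b * p + a) *
    (tfac p al1 e1 a b * tfac p al2 e2 a b)) \in Zloc p.
Proof. by move=> ap; rewrite rpredM // rpredM // rpredM ?Qprod_Zloc ?tfac_Zloc. Qed.

(** Induction on the base p digits: [A_block] writes A(bp + a) as A(b) times a p-integral factor. *)
Lemma poch2_Zloc k : poch r1 k * poch r2 k \in Zloc p.
Proof.
rewrite -/(A k); elim/ltn_ind: k => k IH.
case: (posnP k) => [->|k0]; first by rewrite /A !poch0 mulr1 rpred1.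
rewrite (divn_eq k p) A_block ?ltn_mod ?prime_gt0 //.
by rewrite rpredM ?TZ ?ltn_mod ?prime_gt0 // IH // ltn_Pdiv // prime_gt1.
Qed.

Lemma H_Zloc N : H r1 r2 N \in Zloc p.
Proof. by rewrite H_poch rpred_sum // => k _; apply: poch2_Zloc. Qed.

(** Modulo p the second factor in [A_block] does not depend on b, and its value at b = 0 is A(a)
    because A(0) = 1. *)
Let A_Lucas a b : (a < p)%N -> pcong p 1 (A (b * p + a)) (A b * A a).
Proof.
move=> ap; rewrite A_block //; apply: pcongMl; first exact: poch2_Zloc.
have := A_block 0 ap; rewrite mul0n add0n {2}/A !poch0 !mul1r => ->.
apply: pcongMl => //; apply: pcongM; last exact: tfac2_cong1.
- by rewrite rpredM ?Qprod_Zloc.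
- by rewrite rpredM ?tfac_Zloc.
- apply: (@pcong_leq p p_pr 1 2) => //.
  apply: (@pcong_trans p 2 (1 * 1)).
    by apply: pcongM; rewrite ?Qprod_Zloc ?rpred1 //; apply: Qprod_cong1.
  by apply: pcong_sym; apply: pcongM; rewrite ?Qprod_Zloc ?rpred1 //; apply: Qprod_cong1.
Qed.

Let Hp : H r1 r2 p = f 0.
Proof.
rewrite H_poch; have := sum_A_block 0; rewrite {2}/A !poch0 !mul1r => <-.
by apply: eq_bigr => a _; rewrite mul0n add0n.
Qed.

Let H_mul_gen : (forall b, pcong p 3 (A b * f b) (A b * f 0)) ->
  forall s, pcong p 3 (H r1 r2 (p ^ s.+1)) (H r1 r2 (p ^ s) * H r1 r2 p).
Proof.
move=> h s; rewrite Hp !H_poch expnSr (sum_ord_mul _ _ A) mulr_suml.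
by apply: pcong_sum => b _; rewrite sum_A_block; apply: h.
Qed.

Lemma H_mul s : (4 < p)%N ->
  pcong p 3 (H r1 r2 (p ^ s.+1)) (H r1 r2 (p ^ s) * H r1 r2 p).
Proof.
move=> p4; apply: H_mul_gen => b; apply: pcongMl; first exact: poch2_Zloc.
by apply: pcongMl => //; apply: block_sum_const.
Qed.

(* For p = 2, 3 the block sums f b depend on b modulo p^3, but f b = f 0      *)
(* modulo p^2 still holds, and by the Lucas congruence A b = 0 mod p as soon  *)
(* as A (b mod p) = 0 mod p.                                                  *)
Lemma H_mul_small s :
  (forall a, (a < p)%N -> pcong p 1 (poch r1 a * poch r2 a) 0 \/
     Zunit p (poch r1 a * poch r2 a) /\
     pcong p 3 (\sum_(c < p) poch r1 (a * p + c) * poch r2 (a * p + c))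
               ((poch r1 a * poch r2 a) * H r1 r2 p)) ->
  pcong p 3 (H r1 r2 (p ^ s.+1)) (H r1 r2 (p ^ s) * H r1 r2 p).
Proof.
move=> small; apply: H_mul_gen => b.
have ap : (b %% p < p)%N by rewrite ltn_mod prime_gt0.
case: (small _ ap) => [A0|[Au]].
  have Ab : pcong p 1 (A b) 0.
    rewrite (divn_eq b p); apply: pcong_trans (A_Lucas _ ap) _.
    by rewrite -[0](mulr0 (A (b %/ p))); apply: pcongMl => //; apply: poch2_Zloc.
  rewrite -pcong_sub0 -mulrBr; apply: (@pcong_mul0 p 1 2) => //.
  by rewrite pcong_sub0; apply: pcongMl => //; apply: block_sum_cong2.
rewrite sum_A_block Hp => h; apply: pcongMl; first exact: poch2_Zloc.
apply: (@pcong_trans p 3 (f (b %% p))).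
  by apply: pcongMl => //; apply: block_sum_cong3; rewrite // modn_mod.
have := pcongMl (ZunitV Au) h.
by rewrite !mulKf // (Zunit_neq0 Au).
Qed.

End Dwork.

(** Since h(0) and c are units, so is every h(s), and both quotients are congruent to c. *)
Lemma ratio_congr (p : nat) (h : nat -> rat) (c : rat) : prime p ->
    Zunit p (h 0%N) -> Zunit p c -> (forall s, h s \in Zloc p) ->
    (forall s, pcong p 3 (h s.+1) (h s * c)) ->
  forall s, (1 <= s)%N -> p_congr p 3 (h s.+1 / h s) (h s / h s.-1).
Proof.
move=> p_pr u0 uc hZ hS.
have hu s : Zunit p (h s).
  elim: s => // s IH; apply: (Zunit_cong p_pr _ (pcong_sym (hS s))) => //.
  exact: ZunitM.
have q s : pcong p 3 (h s.+1 / h s) c.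
  have := pcongMr (ZunitV (hu s)) (hS s).
  by rewrite [h s * c]mulrC mulfK // (Zunit_neq0 (hu s)).
have qZ s : p_integral p (h s.+1 / h s).
  by rewrite -[p_integral _ _]/(_ \in Zloc p) rpredM ?ZunitV.
case=> // s _ /=; split=> //.
exact/(pcongP p_pr)/(pcong_trans (q s.+1))/pcong_sym/q.
Qed.

(** * The Dwork map on fractions *)

Section Fractions.

Variables (p : nat) (p_pr : prime p).

(** By Chinese remainders there is x with 0 <= x < dp, x = c modulo d and x = 0 modulo p; it is both
    np and c + d al. *)
Lemma dwork_frac d c : ~~ (p %| d)%N -> (0 < c < d)%N ->
  exists al n : nat, [/\ (al < p)%N, (0 < n < d)%N & (n * p = c + d * al)%N].
Proof.
move=> pd /andP[c0 cd].
have cop : coprime d p by rewrite coprime_sym prime_coprime.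
have d0 : (0 < d)%N by apply: leq_ltn_trans cd.
have p0 := prime_gt0 p_pr.
pose x := (chinese d p c 0 %% (d * p))%N.
have xd : (x %% d = c)%N.
  by rewrite /x modn_dvdm ?dvdn_mulr // chinese_modl // modn_small.
have xp : (p %| x)%N.
  by rewrite /dvdn /x modn_dvdm ?dvdn_mull // chinese_modr // mod0n.
have xlt : (x < d * p)%N by rewrite ltn_mod muln_gt0 d0.
have xE : (x = c + d * (x %/ d))%N by rewrite {1}(divn_eq x d) xd mulnC addnC.
exists (x %/ d)%N, (x %/ p)%N; split.
- by rewrite ltn_divLR // mulnC.
- rewrite divn_gt0 // ltn_divLR // xlt andbT dvdn_leq //.
  by rewrite xE addn_gt0 c0.
- by rewrite divnK.
Qed.

Lemma frac_datum d c al n : ~~ (p %| d)%N -> (n * p = c + d * al)%N ->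
  pcong p 1 (c%:R / d%:R + al%:R) 0 /\
  (c%:R / d%:R + al%:R) / p%:R = n%:R / d%:R :> rat.
Proof.
move=> pd e.
have d0 : d%:R != 0 :> rat by rewrite (Zunit_neq0 (Zunit_nat p_pr pd)).
have p0 : p%:R != 0 :> rat by rewrite pnatr_eq0 -lt0n prime_gt0.
have E : c%:R / d%:R + al%:R = p%:R * (n%:R / d%:R) :> rat.
  have := congr1 (fun x : nat => x%:R : rat) e; rewrite /= natrD !natrM => {}e.
  apply: (mulIf d0); rewrite mulrDl divfK // mulrA divfK //.
  by rewrite [p%:R * _]mulrC e; ring.
split; last by rewrite E mulrC mulKf.
rewrite E; apply: (@pcong_pX p p_pr 1).
by rewrite rpredM ?Zloc_nat // ZunitV // Zunit_nat.
Qed.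

End Fractions.

Lemma frac_nint c d : (0 < c < d)%N -> (c%:R / d%:R : rat) \isn't a Num.int.
Proof.
move=> /andP[c0 cd].
have d0 : (0 : rat) < d%:R by rewrite ltr0n (leq_ltn_trans _ cd).
apply/negP => /intrP[m mE].
have : 0 < m%:~R :> rat by rewrite -mE divr_gt0 // ltr0n.
have : m%:~R < 1 :> rat by rewrite -mE ltr_pdivrMr // mul1r ltr_nat.
by rewrite ltr0z ltrz1; lia.
Qed.

Lemma poch_compl n d k : (0 < d)%N -> (n <= d)%N ->
  poch ((d - n)%N%:R / d%:R) k = poch (n%:R / d%:R) k.
Proof.
move=> d0 nd; rewrite natrB // mulrBl divff ?poch_sym //.
by rewrite pnatr_eq0 -lt0n.
Qed.

(* The Dwork permutation r -> r', with p r' - r in {0, ..., p - 1}, maps c/d  *)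
(* to n/d where n p = c mod d.                                                *)
Definition dwork_stable (p c1 d1 c2 d2 : nat) : Prop :=
  forall n1 n2 al1 al2 k, (0 < n1 < d1)%N -> (0 < n2 < d2)%N ->
    (n1 * p = c1 + d1 * al1)%N -> (n2 * p = c2 + d2 * al2)%N ->
  poch (n1%:R / d1%:R) k * poch (n2%:R / d2%:R) k =
  poch (c1%:R / d1%:R) k * poch (c2%:R / d2%:R) k.

(** The only units modulo 2, 3, 4, 6 are 1 and -1, and [poch] does not see the sign. *)
Lemma poch_unit_frac p d n al k : d \in [:: 2; 3; 4; 6]%N -> (0 < n < d)%N ->
  (n * p = 1 + d * al)%N -> poch (n%:R / d%:R) k = poch (1%:R / d%:R) k.
Proof.
move=> dI nd e; have [->//|n1] := eqVneq n 1%N.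
have nE : n = (d - 1)%N.
  by move: dI; rewrite !inE => /or4P[] /eqP dE; subst d; move: nd n1 e;
    do 6?[case: n => [|n]]; lia.
have d1 : (1 < d)%N by lia.
by rewrite nE poch_compl // ltnW.
Qed.

Lemma dwork_stable_single p d1 d2 :
  d1 \in [:: 2; 3; 4; 6]%N -> d2 \in [:: 2; 3; 4; 6]%N -> dwork_stable p 1 d1 1 d2.
Proof.
move=> I1 I2 n1 n2 al1 al2 k b1 b2 E1 E2.
by rewrite (poch_unit_frac k I1 b1 E1) (poch_unit_frac k I2 b2 E2).
Qed.

(* If n1 p = 1 and n2 p = c modulo d, then n2 = c n1 modulo d. *)
Lemma dwork_stable_pair p d c : (0 < d)%N -> (1 <= c <= d)%N ->
  all (fun n => coprime n d ==>
    (n \in [:: 1; d - 1]%N) && ((c * n) %% d \in [:: c; d - c]%N)%N ||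
    (n \in [:: c; d - c]%N) && ((c * n) %% d \in [:: 1; d - 1]%N)%N) (iota 0 d) ->
  dwork_stable p 1 d c d.
Proof.
move=> d0 /andP[c0 cd] /allP h n1 n2 al1 al2 k /andP[_ n1d] /andP[_ n2d] E1 E2.
have B m n : (m <= d)%N -> n \in [:: m; d - m]%N ->
    poch (n%:R / d%:R) k = poch (m%:R / d%:R) k.
  by move=> md; rewrite !inE => /orP[] /eqP -> //; rewrite poch_compl.
have cop : coprime n1 d.
  rewrite /coprime -dvdn1 -(dvdn_addl _ (dvdn_mulr al1 (dvdn_gcdr n1 d))) -E1.
  by rewrite dvdn_mulr ?dvdn_gcdl.
have n2E : ((c * n1) %% d)%N = n2.
  rewrite -(modn_small n2d) -(modnMDl (n1 * al2) (c * n1)) -(modnMDl (n2 * al1) n2).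
  congr (_ %% _)%N; transitivity (n1 * (n2 * p))%N; first by rewrite E2; ring.
  by rewrite mulnCA E1; ring.
have := h n1; rewrite mem_iota n1d cop n2E /= => /(_ isT)/orP[] /andP[I1 I2].
  by rewrite (B _ _ _ I1) ?(B _ _ cd I2).
by rewrite (B _ _ cd I1) (B _ _ _ I2) // mulrC.
Qed.

(** * The primes 2 and 3, and the listed parameters *)

(** For a = 0 the block sum is H(p) itself; a = 2 occurs only for p = 3, where A(2) is A(1) times a
    3-integral ratio with denominator prime to 3. *)
Lemma small_from_A1 p r1 r2 : prime p -> (p < 5)%N ->
  r1 \in Zloc p -> r2 \in Zloc p -> pcong p 1 (poch r1 1 * poch r2 1) 0 ->
  forall a, (a < p)%N -> pcong p 1 (poch r1 a * poch r2 a) 0 \/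
     Zunit p (poch r1 a * poch r2 a) /\
     pcong p 3 (\sum_(c < p) poch r1 (a * p + c) * poch r2 (a * p + c))
               ((poch r1 a * poch r2 a) * H r1 r2 p).
Proof.
move=> p_pr p5 r1Z r2Z A1 [|[|a]] ap.
- by right; rewrite !poch0 !mul1r Zunit1 H_poch; split.
- by left.
- left; have [p3 a0] : p = 3%N /\ a = 0%N.
    by move: p_pr; case: (p) p5 ap => [|[|[|[|[|]]]]] //; case: a => [|[]].
  subst p a.
  rewrite !(pochS _ 1) mulrACA -[0](mul0r
    ((r1 + 1%:R) * (1 - r1 + 1%:R) / 2%:R ^+ 2 * ((r2 + 1%:R) * (1 - r2 + 1%:R) / 2%:R ^+ 2))).
  apply: pcongMr => //.
  have Z (r : rat) : r \in Zloc 3 -> (r + 1%:R) * (1 - r + 1%:R) / 2%:R ^+ 2 \in Zloc 3.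
    move=> rZ; by rewrite rpredM // rpredM // rpredD ?rpredB ?rpred1.
  by rewrite rpredM ?Z.
Qed.

Lemma dwork_ratio p c1 d1 c2 d2 (r1 := c1%:R / d1%:R) (r2 := c2%:R / d2%:R) :
  prime p -> ~~ (p %| d1)%N -> ~~ (p %| d2)%N -> (0 < c1 < d1)%N -> (0 < c2 < d2)%N ->
  dwork_stable p c1 d1 c2 d2 ->
  ((p < 5)%N -> forall a, (a < p)%N -> pcong p 1 (poch r1 a * poch r2 a) 0 \/
     Zunit p (poch r1 a * poch r2 a) /\
     pcong p 3 (\sum_(c < p) poch r1 (a * p + c) * poch r2 (a * p + c))
               ((poch r1 a * poch r2 a) * H r1 r2 p)) ->
  ~ p_congr p 1 (H r1 r2 p) 0 ->
  forall s, (1 <= s)%N ->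
  p_congr p 3 (H r1 r2 (p ^ s.+1)%N / H r1 r2 (p ^ s)%N)
              (H r1 r2 (p ^ s)%N / H r1 r2 (p ^ s.-1)%N).
Proof.
move=> p_pr pd1 pd2 b1 b2 st small hH.
have [al1 [n1 [l1 m1 E1]]] := dwork_frac p_pr pd1 b1.
have [al2 [n2 [l2 m2 E2]]] := dwork_frac p_pr pd2 b2.
have [D1 F1] := frac_datum p_pr pd1 E1; have [D2 F2] := frac_datum p_pr pd2 E2.
have I1 := frac_nint b1; have I2 := frac_nint b2.
have perm k : poch ((r1 + al1%:R) / p%:R) k * poch ((r2 + al2%:R) / p%:R) k =
              poch r1 k * poch r2 k.
  by rewrite /r1 /r2 F1 F2; apply: st E1 E2.
have HZ := H_Zloc p_pr l1 l2 D1 D2 I1 I2 perm.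
apply: (@ratio_congr p (fun s => H r1 r2 (p ^ s)) (H r1 r2 p)) => //=.
- by rewrite expn0 H_poch big_ord1 !poch0 mulr1 Zunit1.
- case: (Zunit_dichotomy p_pr (HZ p)) => // h; case: hH; split.
  + exact: HZ.
  + exact: (rpred0 (Zloc p)).
  + exact/(pcongP p_pr).
- move=> s; case: (ltnP p 5) => p5.
    exact: (H_mul_small p_pr l1 l2 D1 D2 I1 I2 perm) (small p5).
  exact: (H_mul p_pr l1 l2 D1 D2 I1 I2 perm).
Qed.

Lemma poch1 r : poch r 1 = r * (1 - r).
Proof. by rewrite pochS poch0 mul1r !addr0 expr1n divr1. Qed.

Lemma poch1_Zloc p r : r \in Zloc p -> poch r 1 \in Zloc p.
Proof. by move=> rZ; rewrite poch1 rpredM // rpredB ?rpred1. Qed.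

Lemma poch2_cong0l p r1 r2 : r2 \in Zloc p -> pcong p 1 (poch r1 1) 0 ->
  pcong p 1 (poch r1 1 * poch r2 1) 0.
Proof.
by move=> r2Z h; rewrite -[0](mul0r (poch r2 1)); apply: pcongMr; rewrite ?poch1_Zloc.
Qed.

Lemma poch2_cong0r p r1 r2 : r1 \in Zloc p -> pcong p 1 (poch r2 1) 0 ->
  pcong p 1 (poch r1 1 * poch r2 1) 0.
Proof. by move=> r1Z h; rewrite mulrC; apply: poch2_cong0l. Qed.

Lemma poch_half (r := 1%:R / 2%:R : rat) :
  [/\ poch r 1 = 1 / 2%:R ^+ 2, poch r 2 = 9%:R / 2%:R ^+ 6,
      poch r 3 = 25%:R / 2%:R ^+ 8, poch r 4 = (35%:R ^+ 2) / 2%:R ^+ 14 &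
      poch r 5 = (63%:R ^+ 2) / 2%:R ^+ 16].
Proof.
have B1 : poch r 1 = 1 / 2%:R ^+ 2 by rewrite pochS poch0 /r; field.
have B2 : poch r 2 = 9%:R / 2%:R ^+ 6 by rewrite pochS B1 /r; field.
have B3 : poch r 3 = 25%:R / 2%:R ^+ 8 by rewrite pochS B2 /r; field.
have B4 : poch r 4 = (35%:R ^+ 2) / 2%:R ^+ 14 by rewrite pochS B3 /r; field.
have B5 : poch r 5 = (63%:R ^+ 2) / 2%:R ^+ 16 by rewrite pochS B4 /r; field.
by split; [exact: B1 | exact: B2 | exact: B3 | exact: B4 | exact: B5].
Qed.

(** The one listed case with p < 5 where A(1) is a unit: A(1) = 1/16 at p = 3. The congruence modulo
    27 is checked numerically. *)
Lemma small_half a (r := 1%:R / 2%:R) : (a < 3)%N -> pcong 3 1 (poch r a * poch r a) 0 \/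
     Zunit 3 (poch r a * poch r a) /\
     pcong 3 3 (\sum_(c < 3) poch r (a * 3 + c) * poch r (a * 3 + c))
               ((poch r a * poch r a) * H r r 3).
Proof.
have p3 : prime 3 by [].
have u2 : Zunit 3 2%:R by apply: Zunit_nat.
have Z2 n : 2%:R ^- n \in Zloc 3.
  by rewrite -exprVn; apply: rpredX; apply: ZunitV.
case: a => [|[|[|//]]] _.
- right; rewrite !poch0 !mul1r; split; first exact: Zunit1.
  rewrite H_poch; exact: pcong_refl.
- right; have [B1 B2 B3 B4 B5] := poch_half.
  split.
    rewrite /r B1; apply: ZunitM; rewrite mul1r -exprVn expr2; apply: ZunitM;
      by rewrite /Zunit invr_eq0 invrK (Zunit_neq0 u2) (ZunitV u2) (ZunitW u2).
  rewrite H_poch !big_ord_recr !big_ord0 /= !add0r /r poch0 B1 B2 B3 B4 B5.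
  apply/(pcongP p3).
  (* The difference of the two sides divided by 27, namely -7770301 / 2^32; the denominator is that
     of A(5) = 63^4 / 2^32. *)
  exists (- ((7%:R * 1000%:R + 770%:R) * 1000%:R + 301%:R) / 2%:R ^+ 32).
    apply: rpredM; last exact: Z2.
    rewrite rpredN; apply: (rpredD (rpredM (rpredD (rpredM _ _) _) _) _);
      exact: Zloc_nat.
  by field.
- left; have [_ B2 _ _ _] := poch_half; rewrite /r B2; apply/(pcongP p3).
  exists (27%:R / 2%:R ^+ 12); last by field.
  by apply: rpredM; [exact: Zloc_nat | exact: Z2].
Qed.

Lemma prime_lt5 p : prime p -> (p < 5)%N -> p = 2%N \/ p = 3%N.
Proof. by case: p => [|[|[|[|[|]]]]] //; [left | right]. Qed.

Lemma unit_frac_denq r : r \in [:: 1 / 2; 1 / 3; 1 / 4; 1 / 6] ->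
  exists2 d, d \in [:: 2; 3; 4; 6]%N & r = 1%:R / d%:R /\ `|denq r|%N = d.
Proof.
rewrite !inE => /or4P[] /eqP ->.
- by exists 2%N; rewrite ?inE.
- by exists 3%N; rewrite ?inE.
- by exists 4%N; rewrite ?inE.
- by exists 6%N; rewrite ?inE.
Qed.

Theorem mainTheorem2 (r1 r2 : rat)
  (hr : (r1 \in [:: 1 / 2; 1 / 3; 1 / 4; 1 / 6] /\
         r2 \in [:: 1 / 2; 1 / 3; 1 / 4; 1 / 6]) \/
        (r1, r2) \in [:: (1 / 5, 2 / 5); (1 / 8, 3 / 8);
                         (1 / 10, 3 / 10); (1 / 12, 5 / 12)])
  (p : nat) (hp : prime p) (hpd : ~~ (p %| common_denom r1 r2)%N)
  (hH : ~ p_congr p 1 (H r1 r2 p) 0)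
  (s : nat) (hs : (1 <= s)%N) :
  p_congr p 3 (H r1 r2 (p ^ s.+1)%N / H r1 r2 (p ^ s)%N)
              (H r1 r2 (p ^ s)%N / H r1 r2 (p ^ s.-1)%N).
Proof.
have pd1 : ~~ (p %| `|denq r1|)%N.
  by apply: contra hpd => h; apply: dvdn_trans h (dvdn_lcml _ _).
have pd2 : ~~ (p %| `|denq r2|)%N.
  by apply: contra hpd => h; apply: dvdn_trans h (dvdn_lcmr _ _).
case: hr => [[/unit_frac_denq[d1 I1 [E1 D1]] /unit_frac_denq[d2 I2 [E2 D2]]]|].
  rewrite D1 in pd1; rewrite D2 in pd2; rewrite {}E1 {}E2 in hH *.
  have lt d : d \in [:: 2; 3; 4; 6]%N -> (0 < 1 < d)%N.
    by rewrite !inE => /or4P[] /eqP ->.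
  apply: (dwork_ratio hp pd1 pd2 (lt _ I1) (lt _ I2)) hH s hs.
    exact: dwork_stable_single.
  have Zd d : ~~ (p %| d)%N -> 1%:R / d%:R \in Zloc p.
    by move=> pd; rewrite rpredM ?Zloc_nat // ZunitV // Zunit_nat.
  (* For p = 2 both denominators are 3, and [poch (1/3) 1] = 2/9 is even. For p = 3 they are 2 or 4,
     and [poch (1/4) 1] = 3/16 is divisible by 3, which leaves r1 = r2 = 1/2. *)
  case/(prime_lt5 hp) => pE; move: (Zd _ pd1) (Zd _ pd2);
    rewrite {}pE {p hp hpd Zd} in pd1 pd2 *.
    have dE d : d \in [:: 2; 3; 4; 6]%N -> ~~ (2 %| d)%N -> d = 3%N.
      by rewrite !inE => /or4P[] /eqP ->.
    rewrite (dE _ I1 pd1) (dE _ I2 pd2) => Z _; apply: small_from_A1 => //.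
    apply: poch2_cong0l => //; rewrite poch1.
    by apply/(pcongP (isT : prime 2)); exists (1 / 9%:R); [|field].
  have dE d : d \in [:: 2; 3; 4; 6]%N -> ~~ (3 %| d)%N -> d = 2%N \/ d = 4%N.
    by rewrite !inE => /or4P[] /eqP ->; auto.
  have B4 : pcong 3 1 (poch (1%:R / 4%:R) 1) 0.
    by rewrite poch1; apply/(pcongP (isT : prime 3)); exists (1 / 16%:R); [|field].
  case: (dE _ I1 pd1) => ->; case: (dE _ I2 pd2) => -> Z1 Z2.
  - exact: small_half.
  - by apply: small_from_A1 => //; apply: poch2_cong0r.
  - by apply: small_from_A1 => //; apply: poch2_cong0l.
  - by apply: small_from_A1 => //; apply: poch2_cong0l.
(* Primes below 5 not dividing d: 2 and 3 for d = 5, only 3 for d = 8 and d = 10, none for d = 12.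
   In each case p divides [poch r2 1], which is 6/25, 15/64, 21/100 respectively. *)
rewrite !inE => /or4P[] /eqP [E1 E2]; rewrite {}E1 {}E2 in pd1 pd2 hH *.
- apply: (@dwork_ratio p 1 5 2 5) => //; first exact: dwork_stable_pair.
  case/(prime_lt5 hp) => pE a; rewrite {}pE {p hp hpd pd1 pd2 hH}.
    apply: small_from_A1 => //; apply: poch2_cong0r => //; rewrite poch1.
    by apply/(pcongP (isT : prime 2)); exists (3%:R / 25%:R); [|field].
  apply: small_from_A1 => //; apply: poch2_cong0r => //; rewrite poch1.
  by apply/(pcongP (isT : prime 3)); exists (2%:R / 25%:R); [|field].
- apply: (@dwork_ratio p 1 8 3 8) => //; first exact: dwork_stable_pair.
  case/(prime_lt5 hp) => pE a; rewrite {}pE {p hp hpd hH} // in pd1 pd2 *.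
  apply: small_from_A1 => //; apply: poch2_cong0r => //; rewrite poch1.
  by apply/(pcongP (isT : prime 3)); exists (5%:R / 64%:R); [|field].
- apply: (@dwork_ratio p 1 10 3 10) => //; first exact: dwork_stable_pair.
  case/(prime_lt5 hp) => pE a; rewrite {}pE {p hp hpd hH} // in pd1 pd2 *.
  apply: small_from_A1 => //; apply: poch2_cong0r => //; rewrite poch1.
  by apply/(pcongP (isT : prime 3)); exists (7%:R / 100%:R); [|field].
- apply: (@dwork_ratio p 1 12 5 12) => //; first exact: dwork_stable_pair.
  by case/(prime_lt5 hp) => pE a; rewrite {}pE {p hp hpd hH} // in pd1 pd2 *.
Qed.
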